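(* Let $n \geq 2k$ and let $Y$ be an $s$-EM family of $k$-spaces in $\mathbb{F}_q^n$ of size at least $y := s \left( \begin{bmatrix} n-1 \\ k-1 \end{bmatrix}_q - [\ell-1] \begin{bmatrix} n-2 \\ k-2 \end{bmatrix}_q \right)$. If $16 s \leq \min\{ q^{\frac{n-k-\ell+2}{3}}, q^{\frac{n-k-r}{3}}, q^{\frac{n}2-k+1} \}$, then $Y$ is the union of $s$ intersecting families.
   Context: Here $q$ is a prime power, $[a] = \frac{q^a-1}{q-1}$ and $\begin{bmatrix} a \\ b \end{bmatrix}_q = \prod_{i=0}^{b-1} \frac{[a-i]}{[b-i]}$ is the Gaussian coefficient. Two subspaces are disjoint if they intersect trivially; an $s$-EM family is a family of $k$-spaces containing no $s+1$ pairwise disjoint elements, and an intersecting family is a family of pairwise non-disjoint $k$-spaces. Write $n = mk + r$ with $0 \leq r < k$, and let $\ell$ be the integer with $[\ell-1] < s \leq [\ell]$. *)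

(* Defs.v *)
From HB Require Import structures.
From mathcomp Require Import all_boot all_order all_algebra.
From mathcomp Require Import reals exp.

Set Implicit Arguments.
Unset Strict Implicit.
Unset Printing Implicit Defensive.

Import Order.TTheory GRing.Theory Num.Theory.
Import VectorInternalTheory.

(* The subspaces of a finite-dimensional space over a finite field form a
   finite type; they are a subtype of the square matrices over the field. *)
HB.instance Definition _ (F : finFieldType) (vT : vectType F) :=
  [Countable of {vspace vT} by <:].
HB.instance Definition _ (F : finFieldType) (vT : vectType F) :=
  [Finite of {vspace vT} by <:].

Local Open Scope ring_scope.

Definition qnum (R : fieldType) (q : R) (a : int) : R := (q ^ a - 1) / (q - 1).

(* For a negative lower index the Gaussian coefficient is 0 (not the empty
   product): this matters for [n-2 choose k-2] when k = 1. *)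
Definition qbinom (R : fieldType) (q : R) (a b : int) : R :=
  if b < 0 then 0
  else \prod_(i < `|b|%N) (qnum q (a - i%:Z) / qnum q (b - i%:Z)).

Section Families.

Variables (F : finFieldType) (vT : vectType F).
Implicit Types (U W : {vspace vT}) (Y Z : {set {vspace vT}}) (k s : nat).

Definition disjoint_spaces U W : bool := (U :&: W == 0)%VS.

Definition kspaces_family k Y : Prop := {in Y, forall U, \dim U = k}.

Definition pairwise_disjoint Z : Prop :=
  {in Z &, forall U W, U != W -> disjoint_spaces U W}.

Definition EM_family k s Y : Prop :=
  kspaces_family k Y /\
  ~ exists Z, [/\ Z \subset Y, #|Z| = s.+1 & pairwise_disjoint Z].

Definition intersecting_family k Y : Prop :=
  kspaces_family k Y /\
  {in Y &, forall U W, U != W -> ~~ disjoint_spaces U W}.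

Definition union_of_intersecting k s Y : Prop :=
  exists2 P : 'I_s -> {set {vspace vT}},
    forall i, intersecting_family k (P i) & Y = \bigcup_(i < s) P i.

End Families.

Definition EM_bound (R : fieldType) (q : R) (n k s : nat) (l : int) : R :=
  s%:R * (qbinom q (n%:Z - 1) (k%:Z - 1)
          - qnum q (l - 1) * qbinom q (n%:Z - 2) (k%:Z - 2)).

(* Main.v *)
(**
Write v for the number of k-spaces, c for the number of those through a given
point, and let S be a partial spread of k-spaces covering almost all points.
A translate of S has at most t members in a t-EM family Y, and the size of Y
forces the average number of these members to be nearly t.  Comparing this with
the number of disjoint pairs in Y shows that for t >= 2 some translate has
exactly t members in Y, few members of Y meeting two of them; the members of Y
meeting just one suitable member A of the translate then form an intersecting
family C of size at least 15 c / 32.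

If B and B' are disjoint k-spaces, then fewer than |C| / s members of such a C meet
both.  For n > 2 k this holds because C consists of k-spaces through a common
point.  For n = 2 k, where C may also consist of k-spaces in a hyperplane, it
follows by averaging over the stabilizer of B, or of B and B', of explicit partial
spreads built in the plane over the field with q ^ k elements: these bound the number
of members of C meeting B in dimension i >= 2, and of those meeting both B and B' in
a point.

Consequently the members of Y meeting all of C pairwise intersect, while every other
member of Y is disjoint from all but |C| / s members of C.  Hence the latter form a
(t - 1)-EM family, and its size allows to repeat the argument.
*)
Require Import Defs.
From mathcomp Require Import all_boot all_order all_fingroup all_solvable all_algebra all_field.
From mathcomp Require Import ring lra zify.
From mathcomp Require Import reals exp.

Set Implicit Arguments.
Unset Strict Implicit.
Unset Printing Implicit Defensive.

Import Order.TTheory GRing.Theory Num.Theory.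
Local Open Scope ring_scope.

(** The size of a [t]-EM family is measured against the partial spread [S]: the invariant is that
    [#|Y| * #|S| / v] is at least [t - 1/8]. An intersecting family [P] satisfies
    [#|P| * #|S| <= v], so removing it lowers the quotient by at most 1 and the deficit 1/8 does not
    grow as [t] decreases. This deficit pays for the subtracted term of [y], at most [c / 256], and
    for the vectors missed by [S], a proportion of at most [1 / (16 s)]. The fraction 15/32 is half
    of 15/16: half of the members of [Y] may meet several members of the translate, and
    [t - 1/8 >= 15/16 * t] for [t >= 2]. The obstacle at [n = 2 k] is that [q ^ (n - 2 k) = 1]:
    counting [k]-spaces through points then only yields bounds comparable with [c], and it is the
    packing by partial spreads inside one orbit that brings them down to order [c / q]. *)

(** [L] is the splitting field of ['X^m - 'X] with [m = #|F| ^ d]. The roots are the fixed points of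
    the [d]-th power of the Frobenius map, hence a subfield; as they generate [L] they are all of
    [L], and [m] elements mean dimension [d]. *)
Lemma finField_ext_exists (F : finFieldType) (d : nat) : (0 < d)%N ->
  exists L : splittingFieldType F, \dim {:L} = d.
Proof.
move=> d_gt0; set m := (#|F| ^ d)%N.
have F_gt1 := finNzRing_gt1 F.
have m_gt1 : (1 < m)%N by rewrite (ltn_exp2l 0).
pose q (R : nzRingType) : {poly R} := 'X^m - 'X.
have Dq R : q R = ('X^(m.-1) - 1) * ('X - 0).
  by rewrite subr0 mulrBl mul1r -exprSr prednK // ltnW.
have /FinSplittingFieldFor[/= L splitLq] : q F != 0.
  by rewrite Dq monic_neq0 ?rpredM ?monicXsubC ?monicXnsubC // -ltnS prednK // ltnW.
rewrite [map_poly _ _]rmorphB rmorphXn /= map_polyX -/(q L) in splitLq.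
have [p pr_p pcharF] := finPcharP F.
have pcharL : p \in [pchar L] by rewrite pchar_lalg.
pose Fm := FinFieldExtType L; exists L.
have /finField_galois_generator[/= a _ Da] : (1 <= {:L})%VS by apply: sub1v.
pose Em := fixedSpace (a ^+ d)%g; rewrite /= dimv1 expn1 in Da.
have [zs DqL defL] := splitLq.
(* Since [m] vanishes in [L], [m - 1] is the unit [-1]; so ['X^(m.-1) - 1] is separable and the
   roots are distinct. *)
have mL0 : m%:R = 0 :> L.
  have [n Dn] : exists n, #|F| = (p ^ n)%N.
    by exists (logn p #|pPrimeCharType pcharF|); rewrite -(card_pprimeChar pcharF).
  have n_gt0 : (0 < n)%N by case: n Dn F_gt1 => // ->.
  rewrite /m Dn -expnM natrX pcharf0 // expr0n.
  by rewrite muln_eq0 -!leqn0 leqNgt n_gt0 leqNgt d_gt0.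
have Uzs : uniq zs.
  rewrite -separable_prod_XsubC -(eqp_separable DqL) Dq separable_root andbC.
  have m1F : (m.-1 == 0)%N = false by rewrite -(eqn_add2r 1) addn1 prednK ?gtn_eqF // ltnW.
  rewrite /root !hornerE subr_eq0 eq_sym expr0n m1F oner_eq0 /=.
  rewrite cyclotomic.separable_Xn_sub_1 // -subn1 natrB ?(ltnW m_gt1) //.
  by rewrite mL0 sub0r oppr_eq0 oner_eq0.
have in_zs : zs =i Em.
  move=> z; rewrite -root_prod_XsubC -(eqp_root DqL) (sameP fixedSpaceP eqP).
  rewrite /root !hornerE subr_eq0 /= /m; congr (_ == z).
  elim: (d) => [|i IHi]; first by rewrite gal_id.
  by rewrite expgSr expnSr exprM IHi galM ?Da ?memvf.
have defEm : Em = {:L}%VS.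
  apply/eqP; rewrite eqEsubv subvf -defL -[Em]subfield_closed agenvS //.
  by rewrite subv_add sub1v; apply/span_subvP=> z; rewrite in_zs.
have cardL : #|Fm| = m.
  have /eq_card-> : Fm =i zs by move=> z; rewrite in_zs defEm memvf.
  apply: succn_inj; rewrite (card_uniqP _) //= -(size_prod_XsubC _ id).
  by rewrite -(eqp_size DqL) size_polyDl size_polyXn // size_polyN size_polyX.
have := @card_vspace F (finvect_type L) _ {:finvect_type L}.
rewrite card_vspacef => cL.
apply/eqP; rewrite -(eqn_exp2l _ _ F_gt1) -/m -cardL; apply/eqP.
by rewrite -cL.
Qed.

(** * Automorphisms of the subspace lattice *)

(** By transitivity and a shift of the summation index, the sum over [G] does not depend on the base
    point in [Omega]. Summing over all base points equates the two averages, here without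
    division. *)
Lemma sum_act_transitive (gT : finGroupType) (G : {group gT}) (T : finType)
    (act : gT -> T -> T) (Omega : {set T}) (f : T -> nat) (x : T) :
  (forall g h y, act (g * h)%g y = act h (act g y)) ->
  {in G, forall g, injective (act g)} ->
  {in G & Omega, forall g y, act g y \in Omega} ->
  {in Omega &, forall y z, exists2 g, g \in G & act g y = z} ->
  x \in Omega ->
  (#|Omega| * \sum_(g in G) f (act g x) = #|G| * \sum_(y in Omega) f y)%N.
Proof.
move=> actM act_inj act_stab act_trans Ox.
have const y : y \in Omega ->
    \sum_(g in G) f (act g y) = \sum_(g in G) f (act g x).
  move=> Oy; have [h Gh <-] := act_trans _ _ Ox Oy.
  rewrite [RHS](reindex_inj (mulgI h)) /=.
  by apply: eq_big => g; rewrite ?groupMl // actM.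
rewrite -sum_nat_const -(eq_bigr _ const) exchange_big /= -sum_nat_const.
apply: eq_bigr => g Gg.
have imO : act g @: Omega = Omega.
  apply/eqP; rewrite eqEcard card_imset ?leqnn ?andbT; last exact: act_inj.
  by apply/subsetP=> _ /imsetP[y Oy ->]; apply: act_stab.
by rewrite -[in RHS]imO big_imset //= => y z _ _; apply: act_inj.
Qed.

Section SubspaceAutomorphisms.

Variables (F : finFieldType) (vT : vectType F).
Implicit Types (U W A B : {vspace vT}) (X Y : seq vT).

Lemma disjoint_spacesC U W : disjoint_spaces U W = disjoint_spaces W U.
Proof. by rewrite /disjoint_spaces capvC. Qed.

(* Automorphisms of the subspace lattice: all that the counting arguments need
   about a linear automorphism is that it preserves these dimensions. *)
Definition capdim_aut : {set {perm {vspace vT}}} :=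
  [set s : {perm {vspace vT}} | [forall U : {vspace vT}, forall W : {vspace vT},
             \dim (s U :&: s W) == \dim (U :&: W)]].

Lemma capdim_autP (s : {perm {vspace vT}}) :
  reflect (forall U W, \dim (s U :&: s W) = \dim (U :&: W)) (s \in capdim_aut).
Proof.
rewrite inE; apply: (iffP forallP) => [sP U W | sP U].
  by apply/eqP; have /forallP := sP U; apply.
by apply/forallP => W; apply/eqP.
Qed.

Lemma capdim_aut_group_set : group_set capdim_aut.
Proof.
apply/group_setP; split=> [|s t /capdim_autP sP /capdim_autP tP].
  by apply/capdim_autP => U W; rewrite !perm1.
by apply/capdim_autP => U W; rewrite !permM tP sP.
Qed.
Canonical capdim_aut_group := group capdim_aut_group_set.

Lemma dim_capdim_aut (s : {perm {vspace vT}}) U : s \in capdim_aut -> \dim (s U) = \dim U.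
Proof. by move/capdim_autP/(_ U U); rewrite !capvv. Qed.

Lemma disjoint_capdim_aut (s : {perm {vspace vT}}) U W :
  s \in capdim_aut -> disjoint_spaces (s U) (s W) = disjoint_spaces U W.
Proof. by move/capdim_autP/(_ U W); rewrite /disjoint_spaces -!dimv_eq0 => ->. Qed.

Lemma lfun_capdim_aut (f : 'End(vT)) : lker f == 0%VS ->
  exists2 s : {perm {vspace vT}}, s \in capdim_aut & forall U, s U = (f @: U)%VS.
Proof.
move=> f0; have f_inj : injective (fun U => (f @: U)%VS).
  by move=> U W /eqP; rewrite eq_limg_ker0 // => /eqP.
exists (perm f_inj) => [|U]; last by rewrite permE.
apply/capdim_autP => U W; rewrite !permE -lker0_img_cap //.
by rewrite limg_dim_eq // (eqP f0) capv0.
Qed.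

Lemma free_lfun_exists X Y : free X -> free Y -> size X = size Y ->
  exists2 f : 'End(vT), lker f == 0%VS & map f X = Y.
Proof.
have ext (Z : seq vT) : free Z -> exists2 Z', free (Z ++ Z') &
    size Z' = (\dim {:vT} - size Z)%N /\ <<Z ++ Z'>>%VS = fullv.
  move=> frZ; exists (vbasis (<<Z>>^C)); last first.
    split; first by rewrite size_tuple dimv_compl (eqP frZ).
    by rewrite span_cat (span_basis (vbasisP _)) addv_complf.
  rewrite cat_free frZ (basis_free (vbasisP _)) /=; apply/directv_addP.
  by rewrite (span_basis (vbasisP _)) capv_compl.
move=> frX frY sXY.
have [X' frX' [sX' _]] := ext X frX; have [Y' frY' [sY' spY']] := ext Y frY.
have [f fP] := linear_of_free (X ++ X') (Y ++ Y').
have {}fP : map f (X ++ X') = Y ++ Y'.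
  by apply: fP => //; rewrite !size_cat sX' sY' sXY.
exists (linfun f); last first.
  apply/eqP; move/eqP: fP; rewrite map_cat eqseq_cat ?size_map // => /andP[/eqP<- _].
  by apply/eqP/eq_map => x; rewrite lfunE.
have im_f : (linfun f @: fullv)%VS = fullv.
  apply/eqP; rewrite eqEsubv subvf /= -{1}spY' -fP.
  have -> : map f (X ++ X') = map (linfun f) (X ++ X').
    by apply/eq_map => x; rewrite lfunE.
  by rewrite -limg_span limgS ?subvf.
rewrite -dimv_eq0; have := limg_ker_dim (linfun f) fullv.
by rewrite im_f capfv => /eqP; rewrite -{2}[\dim fullv]add0n eqn_add2r.
Qed.

Lemma free_aut_exists X Y : free X -> free Y -> size X = size Y ->
  exists (s : {perm {vspace vT}}) f, [/\ s \in capdim_aut, forall U, s U = (f @: U)%VS & map (f : 'End(vT)) X = Y].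
Proof.
move=> frX frY sXY; have [f f0 fXY] := free_lfun_exists frX frY sXY.
by have [s sA sf] := lfun_capdim_aut f0; exists s, f.
Qed.

Lemma pair_adapted_basis A B :
  exists X0 X1 X2, [/\ free (X0 ++ X1 ++ X2), <<X0 ++ X1>>%VS = A,
    <<X0 ++ X2>>%VS = B & [/\ size X0 = \dim (A :&: B),
      size X1 = (\dim A - \dim (A :&: B))%N & size X2 = (\dim B - \dim (A :&: B))%N]].
Proof.
exists (vbasis (A :&: B)), (vbasis (A :\: B)), (vbasis (B :\: A)).
have sp U : <<vbasis U>>%VS = U by rewrite (span_basis (vbasisP _)).
have dA := addv_diff_cap A B; have dB := addv_diff_cap B A.
split; last 1 first.
- rewrite !size_tuple; split=> //.
  + by rewrite -(dimv_cap_compl A B) addKn.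
  + by rewrite -(dimv_cap_compl B A) capvC addKn.
- have frU U : free (vbasis U) by apply: basis_free (vbasisP _).
  rewrite !cat_free !frU /= span_cat !sp; apply/andP; split; apply/directv_addP.
    apply/eqP; rewrite -subv0 -(capv_diff A B); apply: capvS => //; exact: diffvSl.
  apply/eqP; rewrite -subv0; apply/subvP => x; rewrite memv_cap => /andP[].
  rewrite memv_cap => /andP[xA xB] /memv_addP[a aA [b bB Dx]].
  have bA : b \in A.
    have -> : b = x - a by rewrite Dx addrC addKr.
    by rewrite rpredB // (subvP (diffvSl _ _) _ aA).
  have b0 : b \in ((B :\: A) :&: A)%VS by rewrite memv_cap bB.
  move: b0; rewrite capv_diff memv0 => /eqP b0; rewrite b0 addr0 in Dx.
  have : a \in ((A :\: B) :&: B)%VS by rewrite memv_cap aA -Dx.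
  by rewrite capv_diff Dx.
- by rewrite span_cat !sp addvC.
- by rewrite span_cat !sp addvC capvC.
Qed.

(** The three dimensions fix the lengths of the adapted bases, which a linear automorphism carries
    into each other. With [A = B] and [A' = B'] this is transitivity on subspaces of one dimension;
    with [B = B'] it concerns the stabilizer of [B]. *)
Lemma capdim_aut_pair_trans A B A' B' :
  \dim A = \dim A' -> \dim B = \dim B' -> \dim (A :&: B) = \dim (A' :&: B') ->
  exists s : {perm {vspace vT}}, [/\ s \in capdim_aut, s A = A' & s B = B'].
Proof.
move=> dA dB dAB.
have [X0 [X1 [X2 [fr spA spB [s0 s1 s2]]]]] := pair_adapted_basis A B.
have [Y0 [Y1 [Y2 [fr' spA' spB' [s0' s1' s2']]]]] := pair_adapted_basis A' B'.
have e0 : size X0 = size Y0 by rewrite s0 s0'.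
have e1 : size X1 = size Y1 by rewrite s1 s1' dA dAB.
have e2 : size X2 = size Y2 by rewrite s2 s2' dB dAB.
have [|s [f [sA sf]]] := free_aut_exists fr fr'; first by rewrite !size_cat e0 e1 e2.
move/eqP; rewrite !map_cat !eqseq_cat ?size_map // => /and3P[/eqP f0 /eqP f1 /eqP f2].
exists s; split=> //; rewrite sf.
  by rewrite -spA -spA' limg_span map_cat f0 f1.
by rewrite -spB -spB' limg_span map_cat f0 f2.
Qed.

End SubspaceAutomorphisms.

Section ComplementaryPair.

Variables (F : finFieldType) (vT : vectType F).
Implicit Types (B X : {vspace vT}).

Lemma dim1_line (U : {vspace vT}) : \dim U = 1%N -> exists2 p, p != 0 & U = <[p]>%VS.
Proof.
move=> dU; exists (vpick U); first by rewrite vpick0 -dimv_eq0 dU.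
by apply/eqP; rewrite eq_sym eqEdim dim_vline vpick0 -dimv_eq0 dU -memvE memv_pick.
Qed.

(** The projection onto [B] has kernel [B']. A vector [c *: p + z] in [B'] lies in [X :&: B' =
    <[p']>], so [z] is in the span of [p] and [p'], hence zero; then [c *: p] is in both [B] and
    [B']. *)
Lemma proj_free B B' X (p p' : vT) (Z : seq vT) :
  (B :&: B' = 0)%VS -> (B + B' = fullv)%VS -> p != 0 ->
  (X :&: B = <[p]>)%VS -> (X :&: B' = <[p']>)%VS ->
  free Z -> (<<Z>> <= X)%VS -> (<<Z>> :&: (<[p]> + <[p']>) = 0)%VS ->
  free (p :: map (daddv_pi B B') Z).
Proof.
move=> capB addB p0 XB XB' frZ ZX ZD.
have pB : p \in B by have := memv_line p; rewrite -XB memv_cap => /andP[].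
have pX : p \in X by have := memv_line p; rewrite -XB memv_cap => /andP[].
have frpZ : free (p :: Z).
  rewrite -cat1s cat_free seq1_free p0 frZ /=.
  apply/directv_addP/eqP; rewrite span_seq1 -subv0.
  by rewrite -ZD capvC capvS ?addvSl.
have := @limg_basis_of _ _ _ (daddv_pi B B') <<p :: Z>>%VS (p :: Z).
rewrite /= daddv_pi_id // => bas; apply/basis_free/bas; last by rewrite /basis_of eqxx.
apply/eqP; rewrite -subv0; apply/subvP => x; rewrite memv_cap memv_ker memv0.
rewrite span_cons => /andP[/memv_addP[_ /vlineP[c ->] [z zZ ->]] pi0].
have xB' : c *: p + z \in B'.
  rewrite -[_ + _](daddv_pi_add (w := c *: p + z) capB) ?addB ?memvf //.
  by rewrite (eqP pi0) add0r memv_pi.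
have zX : z \in X := subvP ZX _ zZ.
have : c *: p + z \in (X :&: B')%VS by rewrite memv_cap xB' rpredD ?rpredZ.
rewrite XB' => /vlineP[d Dd].
have : z \in (<<Z>> :&: (<[p]> + <[p']>))%VS.
  rewrite memv_cap zZ /=.
  have -> : z = - c *: p + d *: p' by rewrite -Dd scaleNr addKr.
  by rewrite memv_add ?rpredZ ?memv_line.
rewrite ZD memv0 => /eqP z0; rewrite z0 addr0 in xB' *.
have : c *: p \in (B :&: B')%VS by rewrite memv_cap xB' rpredZ.
by rewrite capB memv0.
Qed.

(** A normal form of [X] depending on [k] only, which makes the stabilizer of [B] and [B']
    transitive on such [X]. The basis vectors of [X] other than [p] and [p'] are split into
    components in [B] and [B']; [W] and [W'] complete the two bases, by one vector each since here
    [k >= 2]. *)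
Lemma cross_adapted_basis k B B' X :
  (B :&: B' = 0)%VS -> (B + B' = fullv)%VS ->
  \dim B = k -> \dim B' = k -> \dim X = k ->
  \dim (X :&: B) = 1%N -> \dim (X :&: B') = 1%N ->
  exists p p' Z Z' W W', let XB := p :: Z ++ W in let XB' := p' :: Z' ++ W' in
  [/\ free (XB ++ XB'), <<XB>>%VS = B, <<XB'>>%VS = B',
      [/\ size Z = (k - 2)%N, size Z' = (k - 2)%N, size W = (k - (k - 2).+1)%N
        & size W' = (k - (k - 2).+1)%N]
    & <<p :: p' :: [seq (z.1 + z.2)%R | z <- zip Z Z']>>%VS = X].
Proof.
move=> capB addB dB dB' dX dXB dXB'.
have [p p0 XB] := dim1_line dXB; have [p' p'0 XB'] := dim1_line dXB'.
have capB' : (B' :&: B = 0)%VS by rewrite capvC.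
have addB' : (B' + B = fullv)%VS by rewrite addvC.
have lineS : (<[p]> + <[p']> <= X)%VS by rewrite subv_add -XB -XB' !capvSl.
have dD : \dim (<[p]> + <[p']>) = 2%N.
  rewrite dimv_disjoint_sum ?dim_vline ?p0 ?p'0 //.
  apply/eqP; rewrite -subv0 -capB -XB -XB'; exact: capvS (capvSr _ _) (capvSr _ _).
pose E := (X :\: (<[p]> + <[p']>))%VS; pose ZE : seq vT := vbasis E.
have spZ : <<ZE>>%VS = E by rewrite (span_basis (vbasisP _)).
have frZ : free ZE by apply: basis_free (vbasisP _).
have ZX : (<<ZE>> <= X)%VS by rewrite spZ diffvSl.
have ZD : (<<ZE>> :&: (<[p]> + <[p']>) = 0)%VS by rewrite spZ capv_diff.
have ZD' : (<<ZE>> :&: (<[p']> + <[p]>) = 0)%VS by rewrite addvC.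
have sZ : size ZE = (k - 2)%N.
  by rewrite size_tuple -dX -dD -(dimv_cap_compl X (<[p]> + <[p']>)) (capv_idPr lineS) addKn.
have fr := proj_free capB addB p0 XB XB' frZ ZX ZD.
have fr' := proj_free capB' addB' p'0 XB' XB frZ ZX ZD'.
have ext U q (Q : seq vT) : <[q]>%VS = (X :&: U)%VS -> \dim U = k -> free (q :: Q) ->
    {subset Q <= U} -> size Q = (k - 2)%N ->
    exists W, [/\ free (q :: Q ++ W), <<q :: Q ++ W>>%VS = U & size W = (k - (k - 2).+1)%N].
  move=> qU dU frQ QU sQ; have QS : (<<q :: Q>> <= U)%VS.
    rewrite span_cons subv_add qU capvSr /=; exact/span_subvP.
  exists (vbasis (U :\: <<q :: Q>>)).
  have sW : <<q :: Q ++ vbasis (U :\: <<q :: Q>>)>>%VS = U.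
    rewrite -cat_cons span_cat (span_basis (vbasisP _)) addvC addv_diff.
    exact/addv_idPl.
  split=> //; last first.
    rewrite size_tuple; have := dimv_cap_compl U <<q :: Q>>.
    rewrite (capv_idPr QS) dU; move/eqP: frQ => -> /=; rewrite sQ => dk.
    by rewrite -{1}dk addKn.
  rewrite -cat_cons cat_free frQ (basis_free (vbasisP _)); apply/directv_addP.
  by rewrite (span_basis (vbasisP _)) capvC capv_diff.
have sub U U' : {subset map (daddv_pi U U') ZE <= U}.
  by move=> _ /mapP[z _ ->]; rewrite memv_pi.
have [||W [frW spW sW]] := ext B _ _ (esym XB) dB fr; rewrite ?size_map //.
have [||W' [frW' spW' sW']] := ext B' _ _ (esym XB') dB' fr'; rewrite ?size_map //.
exists p, p', (map (daddv_pi B B') ZE), (map (daddv_pi B' B) ZE), W, W' => /=.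
rewrite !size_map; split=> //.
- by rewrite -cat_cons cat_free frW frW' spW spW'; apply/directv_addP.
have -> : [seq z.1 + z.2 | z <- zip (map (daddv_pi B B') ZE) (map (daddv_pi B' B) ZE)] = ZE.
  elim: (ZE) => //= z s ->; rewrite daddv_pi_add ?addB ?memvf //.
rewrite !span_cons spZ addvA addvC.
by rewrite addv_diff; apply/addv_idPl.
Qed.

Lemma capdim_aut_cross_trans k B B' X X' :
  (B :&: B' = 0)%VS -> (B + B' = fullv)%VS -> \dim B = k -> \dim B' = k ->
  \dim X = k -> \dim (X :&: B) = 1%N -> \dim (X :&: B') = 1%N ->
  \dim X' = k -> \dim (X' :&: B) = 1%N -> \dim (X' :&: B') = 1%N ->
  exists s : {perm {vspace vT}}, [/\ s \in capdim_aut vT, s B = B, s B' = B' & s X = X'].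
Proof.
move=> capB addB dB dB' dX dXB dXB' dY dYB dYB'.
have [p [p' [Z [Z' [W [W' [fr sB sB' [sZ sZ' sW sW'] sX]]]]]]] :=
  cross_adapted_basis capB addB dB dB' dX dXB dXB'.
have [r [r' [T [T' [S [S' [fr2 tB tB' [tZ tZ' tW tW'] tX]]]]]]] :=
  cross_adapted_basis capB addB dB dB' dY dYB dYB'.
have e1 : size Z = size T by rewrite sZ tZ.
have e2 : size Z' = size T' by rewrite sZ' tZ'.
have e3 : size W = size S by rewrite sW tW.
have e4 : size W' = size S' by rewrite sW' tW'.
have [|s [f [sA sf]]] := free_aut_exists fr fr2.
  by rewrite /= !size_cat /= !size_cat e1 e2 e3 e4.
move/eqP; rewrite /= !map_cat /= !map_cat.
rewrite eqseq_cons -!catA !eqseq_cat ?size_map // eqseq_cons eqseq_cat ?size_map //.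
case/and5P=> /eqP fp /eqP fZ /eqP fW /eqP fp' /andP[/eqP fZ' /eqP fW'].
exists s; split=> //; rewrite sf.
- by rewrite -{1}sB -tB limg_span /= map_cat fp fZ fW.
- by rewrite -{1}sB' -tB' limg_span /= map_cat fp' fZ' fW'.
rewrite -sX -tX limg_span /= fp fp' -fZ -fZ'; congr (<< _ :: _ :: _ >>)%VS.
rewrite -map_comp; elim: (Z) (Z') => [|z s1 IH] [|z' s2] //=.
by rewrite linearD IH.
Qed.

End ComplementaryPair.

(** * Counting subspaces *)

Section Counting.

Variables (F : finFieldType) (n : nat).
Local Notation V := 'rV[F]_n.
Local Notation q := #|F|.
Implicit Types (U W A B X : {vspace V}) (C : {set {vspace V}}) (x : V).

Definition kspaces (k : nat) : {set {vspace V}} := [set U | \dim U == k].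
Definition above C U : {set {vspace V}} := [set W in C | (U <= W)%VS].

Lemma q_gt1 : (1 < q)%N. Proof. exact: finNzRing_gt1. Qed.
Lemma expq_gt0 i : (0 < q ^ i)%N. Proof. by rewrite expn_gt0 ltnW ?q_gt1. Qed.
Hint Resolve expq_gt0 q_gt1 : core.

Lemma dim_rVf : \dim {:V} = n.
Proof. by rewrite dimvf; apply: mul1n. Qed.

Lemma card_subspace U : #|[set x in U]| = (q ^ \dim U)%N.
Proof. by rewrite cardsE card_vspace. Qed.

Lemma card_subspaceD U W : (W <= U)%VS ->
  #|[set x in U | x \notin W]| = (q ^ \dim U - q ^ \dim W)%N.
Proof.
move=> WU; rewrite -!card_subspace -(cardsID [set x in W] [set x in U]).
have -> : [set x in U] :&: [set x in W] = [set x in W].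
  apply/setIidPr/subsetP => x; rewrite !inE; exact: (subvP WU).
rewrite addKn; apply: eq_card => x; rewrite !inE.
by rewrite andbC.
Qed.

Lemma card_subspaceD_ge U W :
  (q ^ \dim U - q ^ \dim W <= #|[set x in U | x \notin W]|)%N.
Proof.
rewrite -!card_subspace leq_subLR -(cardsID [set x in W] [set x in U]).
apply: leq_add; first by rewrite subset_leq_card // subsetIr.
by rewrite subset_leq_card //; apply/subsetP => x; rewrite !inE andbC.
Qed.

Lemma card_subspaceD0 U : #|[set x in U | x != 0]| = (q ^ \dim U - 1)%N.
Proof.
have := card_subspaceD (sub0v U); rewrite dimv0 expn0 => <-.
by apply: eq_card => x; rewrite !inE memv0.
Qed.

Lemma addv_line_sub U W x : (U + <[x]> <= W)%VS = (U <= W)%VS && (x \in W).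
Proof. by rewrite subv_add -memvE. Qed.

Lemma dim_add_line U x : x \notin U -> \dim (U + <[x]>) = (\dim U).+1.
Proof.
move=> xU; have x0 : x != 0 by apply: contraNneq xU => ->; rewrite mem0v.
rewrite dimv_disjoint_sum ?dim_vline ?x0 ?addn1 //.
apply/eqP; rewrite -subv0; apply/subvP => y; rewrite memv_cap memv0.
case/andP=> yU /vlineP[c Dy]; have [c0|c0] := eqVneq c 0; first by rewrite Dy c0 scale0r.
by case/negP: xU; rewrite -(scalerK c0 x) -Dy rpredZ.
Qed.

Lemma above_double_count C U A :
  (\sum_(X in above C U) #|[set x in (X :&: A)%VS | x \notin U]|
   = \sum_(x in [set x in A | x \notin U]) #|above C (U + <[x]>)|)%N.
Proof.
under eq_bigr do rewrite -sum1_card.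
under [RHS]eq_bigr do rewrite -sum1_card.
rewrite (exchange_big_dep (mem [set x in A | x \notin U])) /=; last first.
  by move=> X x _; rewrite !inE memv_cap => /andP[/andP[_ ->] ->].
apply: eq_bigr => x; rewrite inE => /andP[xA xU]; apply: eq_bigl => X.
by rewrite !inE memv_cap addv_line_sub xA xU /= !andbT andbA.
Qed.

(** Double counting of members [X] above [U] and vectors of [X :&: A] outside [U]. The bound for [U
    + <[x]>] is [b / Q], with [Q] kept as a factor to avoid division. Vectors are counted rather
    than points, whence the factors [q - 1] in later values of [w]. *)
Lemma above_step C U A w Q b :
  (forall X, X \in above C U -> (w <= #|[set x in (X :&: A)%VS | x \notin U]|)%N) ->
  (forall x, x \in A -> x \notin U -> (#|above C (U + <[x]>)| * Q <= b)%N) ->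
  (w * #|above C U| * Q <= #|[set x in A | x \notin U]| * b)%N.
Proof.
move=> wP bP; apply: (@leq_trans ((\sum_(X in above C U) #|[set x in (X :&: A)%VS | x \notin U]|) * Q)).
  by rewrite leq_mul2r mulnC -sum_nat_const; apply/orP; right; apply: leq_sum.
rewrite above_double_count -sum_nat_const big_distrl /=; apply: leq_sum => x; rewrite inE.
by case/andP; apply: bP.
Qed.

Variable k : nat.
Hypothesis k_le_n : (k <= n)%N.
Local Notation c U := #|above (kspaces k) U|.

Lemma above_kspacesE U W : (W \in above (kspaces k) U) = (\dim W == k) && (U <= W)%VS.
Proof. by rewrite !inE. Qed.

Lemma above0 C : above C 0 = C.
Proof. by apply/setP => W; rewrite !inE sub0v andbT. Qed.

Lemma card_above_dim U W : \dim U = \dim W -> c U = c W.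
Proof.
move=> dUW; have [|s [sA sU _]] := @capdim_aut_pair_trans _ _ U U W W dUW dUW.
  by rewrite !capvv.
have leP (X Y : {vspace V}) : (s X <= s Y)%VS = (X <= Y)%VS.
  move/capdim_autP/(_ X Y): (sA) => dXY.
  apply/idP/idP => /capv_idPl => [e|e].
    rewrite e (dim_capdim_aut _ sA) in dXY; apply/capv_idPl/eqP.
    by rewrite eqEdim capvSl dXY leqnn.
  rewrite e -(dim_capdim_aut X sA) in dXY; apply/capv_idPl/eqP.
  by rewrite eqEdim capvSl dXY leqnn.
rewrite -(card_imset _ (@perm_inj _ s)); apply: eq_card => X.
apply/imsetP/idP => [[Y]|]; rewrite !inE.
  by case/andP=> dY UY ->; rewrite (dim_capdim_aut _ sA) dY -sU leP.
case/andP=> dX WX; exists ((s^-1)%g X); last by rewrite permKV.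
by rewrite !inE -leP -(dim_capdim_aut _ sA) permKV dX sU WX.
Qed.

Lemma above_rec U x : x \notin U ->
  ((q ^ k - q ^ \dim U) * c U = (q ^ n - q ^ \dim U) * c (U + <[x]>))%N.
Proof.
move=> xU; have := above_double_count (kspaces k) U fullv.
rewrite (eq_bigr (fun=> (q ^ k - q ^ \dim U)%N)); last first.
  move=> X; rewrite above_kspacesE => /andP[/eqP <- UX].
  by rewrite capvf card_subspaceD.
rewrite sum_nat_const mulnC => ->.
rewrite (eq_bigr (fun=> c (U + <[x]>))); last first.
  move=> y; rewrite inE => /andP[_ yU]; apply: card_above_dim.
  by rewrite !dim_add_line.
by rewrite sum_nat_const card_subspaceD ?subvf // dim_rVf.
Qed.

Lemma above_line_rec x : x != 0 -> ((q ^ k - 1) * #|kspaces k| = (q ^ n - 1) * c <[x]>)%N.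
Proof.
move=> x0; have := @above_rec 0 x; rewrite memv0 => /(_ x0).
by rewrite dimv0 expn0 above0 add0v.
Qed.

Lemma above_step_le U x : x \notin U -> (c (U + <[x]>) * q ^ (n - k) <= c U)%N.
Proof.
move=> xU; have [kU|Uk] := leqP k (\dim U).
  rewrite eq_card0 // => W; rewrite above_kspacesE; apply/negbTE/negP.
  case/andP=> /eqP dW /dimvS; rewrite dim_add_line // dW ltnNge.
  by rewrite kU.
have e := above_rec xU.
have pos : (0 < q ^ k - q ^ \dim U)%N by rewrite subn_gt0 ltn_exp2l.
(* The ratio [(q ^ n - q ^ u) / (q ^ k - q ^ u)] of the recursion, [u = \dim U], is at least
   [q ^ (n - k)]. *)
rewrite -(leq_pmul2l pos) e [X in (_ <= X)%N]mulnC mulnCA leq_mul2l; apply/orP; right.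
rewrite mulnC mulnBr -expnD subnK // leq_sub2l //.
by rewrite leq_pmull.
Qed.

End Counting.

Section Packing.

Variables (F : finFieldType) (n : nat).
Local Notation V := 'rV[F]_n.
Implicit Types (U W A B X : {vspace V}) (C S Y Z Omega : {set {vspace V}}) (k : nat).

Lemma kspace_self_meet k U : (0 < k)%N -> \dim U = k -> ~~ disjoint_spaces U U.
Proof. by move=> k0 dU; rewrite /disjoint_spaces capvv -dimv_eq0 dU -lt0n. Qed.

Lemma intersecting_meet k C U W :
  (0 < k)%N -> intersecting_family k C -> U \in C -> W \in C -> ~~ disjoint_spaces U W.
Proof.
move=> k0 [Ck Cm] UC WC; have [<-|UW] := eqVneq U W; last exact: Cm.
exact: kspace_self_meet k0 (Ck _ UC).
Qed.

Lemma pairwise_disjointU1 X Z : pairwise_disjoint Z ->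
  {in Z, forall U, disjoint_spaces X U} -> pairwise_disjoint (X |: Z).
Proof.
move=> Zd XZ U W /setU1P[->|UZ] /setU1P[->|WZ] neq.
- by rewrite eqxx in neq.
- exact: XZ.
- by rewrite disjoint_spacesC XZ.
- exact: Zd.
Qed.

Lemma notin_disjoint k X Z : (0 < k)%N -> \dim X = k ->
  {in Z, forall U, disjoint_spaces X U} -> X \notin Z.
Proof.
move=> k0 dX XZ; apply/negP => /XZ; apply/negP; exact: kspace_self_meet k0 dX.
Qed.

Lemma EM_meet k s Y Z X : (0 < k)%N -> EM_family k s Y -> Z \subset Y ->
  pairwise_disjoint Z -> #|Z| = s -> X \in Y -> exists2 A, A \in Z & ~~ disjoint_spaces A X.
Proof.
move=> k0 [Yk YEM] ZY Zd sZ XY; apply/exists_inP; apply: contraT => /exists_inPn nZ.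
have XZ : {in Z, forall U, disjoint_spaces X U}.
  by move=> U UZ; rewrite disjoint_spacesC; apply/negPn/nZ.
case: YEM; exists (X |: Z); split; last exact: pairwise_disjointU1.
  by rewrite subUset sub1set XY.
by rewrite cardsU1 (notin_disjoint k0 (Yk _ XY) XZ) sZ.
Qed.

Definition stab2 B B' : {set {perm {vspace V}}} :=
  [set s in capdim_aut V | (s B == B) && (s B' == B')].

Lemma stab2P B B' (s : {perm {vspace V}}) :
  reflect [/\ s \in capdim_aut V, s B = B & s B' = B'] (s \in stab2 B B').
Proof.
by rewrite [_ \in stab2 _ _]in_set; apply: (iffP and3P) => [[sA /eqP-> /eqP->]|[sA -> ->]].
Qed.

Lemma stab2_group_set B B' : group_set (stab2 B B').
Proof.
apply/group_setP; split; first by apply/stab2P; rewrite group1 !perm1.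
move=> s t /stab2P[sA sB sB'] /stab2P[tA tB tB']; apply/stab2P.
by rewrite groupM ?permM ?sB ?sB'.
Qed.
Canonical stab2_group B B' := group (stab2_group_set B B').

(* Averaging over the translates of a partial spread [S]: each translate meets
   the intersecting family [C] at most once. *)
Lemma transitive_packing k (H : {group {perm {vspace V}}}) Omega S C :
  H \subset capdim_aut V ->
  {in H & Omega, forall (s : {perm _}) U, s U \in Omega} ->
  {in Omega &, forall U W, exists2 s : {perm {vspace V}}, s \in H & s U = W} ->
  S \subset Omega -> pairwise_disjoint S -> intersecting_family k C ->
  (#|C :&: Omega| * #|S| <= #|Omega|)%N.
Proof.
move=> /subsetP HA stab trans SO Sd [_ Cm].
have avg A : A \in S ->
    (#|Omega| * \sum_(g in H) ((g A \in C) : nat) = #|H| * #|C :&: Omega|)%N.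
  move=> AS; have := @sum_act_transitive _ H _ (fun g U => g U) Omega (fun U => (U \in C) : nat) A.
  move=> -> //; first 1 last.
  - by move=> g h U; rewrite permM.
  - by move=> g _; apply: perm_inj.
  - exact: (subsetP SO).
  by rewrite -big_mkcondr sum1_card; congr (_ * _)%N; apply: eq_card => U; rewrite !inE andbC.
have W1 (g : {perm {vspace V}}) : g \in H -> (\sum_(A in S) ((g A \in C) : nat) <= 1)%N.
  move=> gH; rewrite -big_mkcondr sum1_card; apply/card_le1_eqP => A B.
  rewrite !unfold_in => /andP[AS gAC] /andP[BS gBC]; apply/eqP; apply: contraT => AB.
  rewrite eq_sym in AB; have := Cm _ _ gAC gBC; rewrite (inj_eq perm_inj) => /(_ AB).
  by rewrite disjoint_capdim_aut ?HA // (Sd _ _ AS BS AB).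
have key : (#|Omega| * \sum_(g in H) \sum_(A in S) ((g A \in C) : nat)
            = #|S| * (#|H| * #|C :&: Omega|))%N.
  by rewrite exchange_big /= big_distrr /= -sum_nat_const; apply: eq_bigr.
rewrite -(leq_pmul2l (cardG_gt0 H)) mulnA [X in (X <= _)%N]mulnC -key mulnC leq_mul2r.
by rewrite -[X in (_ <= X)%N]sum1_card leq_sum ?orbT.
Qed.

Lemma intersecting_kspaces k C : intersecting_family k C -> C \subset kspaces F n k.
Proof. by case=> Ck _; apply/subsetP => U /Ck/eqP; rewrite inE. Qed.

Lemma kspaces_trans k : {in kspaces F n k &, forall U W,
  exists2 s : {perm {vspace V}}, s \in capdim_aut V & s U = W}.
Proof.
move=> U W; rewrite !inE => /eqP dU /eqP dW.
have [|||s [sA sU _]] := @capdim_aut_pair_trans _ _ U U W W; rewrite ?capvv ?dU ?dW //.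
by exists s.
Qed.

Lemma kspaces_stable k : {in capdim_aut V & kspaces F n k, forall (s : {perm _}) U,
  s U \in kspaces F n k}.
Proof. by move=> s U sA; rewrite !inE dim_capdim_aut. Qed.

Lemma partial_spread_bound k S C : S \subset kspaces F n k -> pairwise_disjoint S ->
  intersecting_family k C -> (#|C| * #|S| <= #|kspaces F n k|)%N.
Proof.
move=> SO Sd CI; have := transitive_packing (subxx _) (@kspaces_stable k) (@kspaces_trans k) SO Sd CI.
by rewrite (setIidPl (intersecting_kspaces CI)).
Qed.

End Packing.

(** * A large intersecting subfamily *)

(* [mu] and [w2] are the averages of [#|hit g|] and [#|hit g| * (#|hit g| - 1)], and
   [e] is the number of disjoint pairs in [Y]; the bound on [w2] comes from
   [0 <= (s - w) * (s - 1 - w)] for every integer [w <= s]. *)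
Lemma translate_average_contra (R : realFieldType) (s mu w2 M y v N e D mt : R) :
  2 <= s -> 0 < v -> 0 < N -> 0 <= e ->
  v * mu = N * y -> D * w2 = N * (N - 1) * e -> v * M + N * e = N * y ^+ 2 ->
  (2 * s - 2) * mu <= w2 + s * (s - 1) -> mu <= s -> 3 * y <= 2 * M + 3 * y * (s - mu) ->
  v ^+ 2 <= D + v * mt -> 4 * s * mt <= v -> 8 * s * v <= 8 * y * N + v -> False.
Proof.
move=> s2 v0 N0 e0 vmu Dw2 vM w2P mus yM DP mtP yP.
have mu_ge : s - 8^-1 <= mu.
  rewrite -(ler_pM2l v0) vmu; lra.
pose d := s - mu; have d_ge0 : 0 <= d by rewrite /d; lra.
have d_le : d <= 8^-1 by rewrite /d; lra.
have Emu : mu = s - d by rewrite /d; ring.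
(* This is [(2 * s - 2) * mu - s * (s - 1)], a lower bound for [w2]. *)
pose T := (s - 1) * (s - 2 * d).
have T_le : T <= w2 by rewrite /T /d; lra.
have T_ge0 : 0 <= T by rewrite /T mulr_ge0 //; lra.
have s_gt0 : 0 < s by lra.
have s4 : (4 * s) * (4 * s)^-1 = 1 by rewrite mulfV // gt_eqF //; lra.
have D_ge : v ^+ 2 * (1 - (4 * s)^-1) <= D.
  have : v * (v * (4 * s)^-1) >= v * mt.
    by rewrite ler_pM2l // ler_pdivlMr 1?mulrC //; lra.
  rewrite expr2; move: DP; rewrite expr2; lra.
have c_ge0 : 0 <= 1 - (4 * s)^-1.
  by rewrite subr_ge0 invf_le1; lra.
have D_ge0 : 0 <= D by apply: le_trans D_ge; rewrite mulr_ge0 ?sqr_ge0.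
have NNe : v ^+ 2 * (1 - (4 * s)^-1) * T <= N ^+ 2 * e.
  have : D * T <= N ^+ 2 * e.
    apply: (@le_trans _ _ (D * w2)); first exact: ler_wpM2l.
    by rewrite Dw2 expr2 ler_wpM2r // ler_wpM2l; lra.
  apply: le_trans; exact: ler_wpM2r.
have MN : M * N <= v * (mu ^+ 2 - (1 - (4 * s)^-1) * T).
  rewrite -(ler_pM2l v0).
  have -> : v * (M * N) = (v * mu) ^+ 2 - N ^+ 2 * e.
    have -> : v * (M * N) = N * (v * M) by ring.
    have -> : v * M = N * y ^+ 2 - N * e by rewrite -vM; ring.
    by rewrite vmu; ring.
  have -> : v * (v * (mu ^+ 2 - (1 - (4 * s)^-1) * T))
     = (v * mu) ^+ 2 - v ^+ 2 * (1 - (4 * s)^-1) * T by ring.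
  by rewrite lerD2l lerN2.
have MN' : v * (3 * (mu * (1 - d))) <= v * (2 * (mu ^+ 2 - (1 - (4 * s)^-1) * T)).
  have -> : v * (3 * (mu * (1 - d))) = N * (3 * y - 3 * y * (s - mu)).
    have -> : v * (3 * (mu * (1 - d))) = (v * mu) * (3 * (1 - d)) by ring.
    by rewrite vmu /d; ring.
  apply: (@le_trans _ _ (N * (2 * M))); first by rewrite ler_pM2l //; lra.
  have -> : N * (2 * M) = 2 * (M * N) by ring.
  have -> : v * (2 * (mu ^+ 2 - (1 - (4 * s)^-1) * T)) = 2 * (v * (mu ^+ 2 - (1 - (4 * s)^-1) * T)) by ring.
  by rewrite ler_pM2l.
rewrite ler_pM2l // in MN'.
(* As [mu = s - d] and [d <= 1/8], the left side of [MN'] is at least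
   [21/8 * s - 3 * d + 3 * d ^+ 2], and the right side at most [5/2 * s - 5 * d + 2 * d ^+ 2], which
   is smaller. *)
have rT : (4 * s)^-1 * T <= (s - 2 * d) / 4.
  rewrite mulrC ler_pdivrMr; last by lra.
  have -> : (s - 2 * d) / 4 * (4 * s) = s * (s - 2 * d) by field.
  by rewrite /T ler_wpM2r; lra.
have sd : s * d <= s / 8 by rewrite ler_wpM2l // ?ltW //; lra.
have d2 : 0 <= d ^+ 2 := sqr_ge0 d.
move: MN'; rewrite Emu.
have -> : 3 * ((s - d) * (1 - d)) = 3 * s - 3 * d - 3 * (s * d) + 3 * d ^+ 2 by ring.
have -> : 2 * ((s - d) ^+ 2 - (1 - (4 * s)^-1) * T) =
  2 * s - 4 * d + 2 * d ^+ 2 + 2 * ((4 * s)^-1 * T) by rewrite /T; ring.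
lra.
Qed.

Lemma translate_average_contra_nat (s K N G D e SW SW2 SM m y mt : nat) :
  (1 < s)%N -> (0 < K)%N -> (0 < N)%N -> (0 < G)%N ->
  (K * SW = N * (G * y))%N -> (D * SW2 = N * N.-1 * (G * e))%N ->
  (K * SM = N * (G * m))%N -> (e + m = y * y)%N ->
  (3 * y * G + 3 * y * SW <= 2 * SM + 3 * y * (s * G))%N ->
  ((2 * s - 2) * SW <= SW2 + s * s.-1 * G)%N -> (SW <= s * G)%N ->
  (K * K <= D + K * mt)%N -> (4 * s * mt <= K)%N -> (8 * s * K <= 8 * y * N + K)%N ->
  False.
Proof.
case: s N => [|s] [|N] //; rewrite !ltnS /= => s0 K0 _ G0.
have -> : (2 * s.+1 - 2 = 2 * s)%N by rewrite mulnS addKn.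
have inj (a b : nat) : a = b -> (a%:R : rat) = b%:R by move->.
have cast (a b : nat) : (a <= b)%N -> (a%:R : rat) <= b%:R by rewrite ler_nat.
move=> /inj s1 /inj s2 /inj s3 /inj dY /cast b1 /cast b2 /cast b3 /cast DP /cast mtP /cast yP.
rewrite !(natrM, natrD) -?[s.+1%:R]natr1 -?[N.+1%:R]natr1 in s1 s2 s3 dY b1 b2 b3 DP mtP yP.
have G0' : (0 : rat) < G%:R by rewrite ltr0n.
have K0' : (0 : rat) < K%:R by rewrite ltr0n.
have s0' : (1 : rat) <= s%:R by rewrite (ler_nat _ 1).
have N0' : (0 : rat) <= N%:R by rewrite ler0n.
have e0' : (0 : rat) <= e%:R by rewrite ler0n.
have Gn0 : (G%:R : rat) != 0 by rewrite gt_eqF.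
move: s1 s2 s3 dY b1 b2 b3 DP mtP yP G0' K0' s0' N0' e0' Gn0.
move: (s%:R : rat) (N%:R : rat) (K%:R : rat) (G%:R : rat) (D%:R : rat) (e%:R : rat).
move: (SW%:R : rat) (SW2%:R : rat) (SM%:R : rat) (m%:R : rat) (y%:R : rat) (mt%:R : rat).
move=> W' W2' M' m' y' mt' s' N' K' G' D' e' s1 s2 s3 dY b1 b2 b3 DP mtP yP G0' K0' s0' N0' e0' Gn0.
apply: (@translate_average_contra _ (s' + 1) (W' / G') (W2' / G') (M' / G') y' K' (N' + 1) e' D' mt') => //.
- by lra.
- by lra.
- by rewrite mulrA s1; field.
- by rewrite mulrA s2; field.
- by rewrite mulrA s3 expr2 -dY; field.
- rewrite -(ler_pM2r G0').
  have -> : (2 * (s' + 1) - 2) * (W' / G') * G' = 2 * s' * W' by field.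
  have -> : (W2' / G' + (s' + 1) * (s' + 1 - 1)) * G' = W2' + (s' + 1) * s' * G' by field.
  by [].
- by rewrite ler_pdivrMr.
- rewrite -(ler_pM2r G0').
  have -> : (2 * (M' / G') + 3 * y' * (s' + 1 - W' / G')) * G' =
     2 * M' + 3 * y' * ((s' + 1) * G') - 3 * y' * W' by field.
  lra.
Qed.

Section LargeIntersecting.

Variables (F : finFieldType) (n k s : nat).
Local Notation V := 'rV[F]_n.
Local Notation K := (kspaces F n k).
Local Notation Aut := (capdim_aut V).
Variables (Y S : {set {vspace V}}) (mt : nat).
Hypotheses (k_gt0 : (0 < k)%N) (s_gt1 : (1 < s)%N).
Hypotheses (YEM : EM_family k s Y) (SK : S \subset K) (Sd : pairwise_disjoint S).
Hypothesis K_gt0 : (0 < #|K|)%N.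
Hypothesis mtP : {in K, forall A, (#|[set X in K | ~~ disjoint_spaces A X]| <= mt)%N}.
Hypothesis mt_small : (4 * s * mt <= #|K|)%N.
Hypothesis Y_large : (8 * s * #|K| <= 8 * #|Y| * #|S| + #|K|)%N.

Let YK : Y \subset K.
Proof. by apply/subsetP => U /(proj1 YEM)/eqP; rewrite inE. Qed.

Definition hit (g : {perm {vspace V}}) := [set A in S | g A \in Y].
Definition degm (A : {vspace V}) := #|[set X in Y | ~~ disjoint_spaces A X]|.
Definition dpairs (Z : {set {vspace V}}) : {set {vspace V} * {vspace V}} :=
  [set p | [&& p.1 \in Z, p.2 \in Z & disjoint_spaces p.1 p.2]].

Lemma hit_le (g : {perm {vspace V}}) : g \in Aut -> (#|hit g| <= s)%N.
Proof.
move=> gA; rewrite leqNgt; apply/negP => hg.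
case: (proj2 YEM); have [Z /subsetP Zh sZ] : exists2 Z : {set {vspace V}}, Z \subset hit g & #|Z| = s.+1.
  have /card_geqP[t [ut st tP]] := hg; exists [set A in t].
    by apply/subsetP => A; rewrite inE => /tP.
  by rewrite cardsE (card_uniqP ut) st.
exists [set g A | A in Z]; split; last first.
- move=> _ _ /imsetP[A AZ ->] /imsetP[B BZ ->]; rewrite (inj_eq perm_inj) => AB.
  have := Zh _ AZ; have := Zh _ BZ; rewrite !inE => /andP[BS _] /andP[AS _].
  by rewrite disjoint_capdim_aut // Sd.
- by rewrite card_imset ?sZ //; apply: perm_inj.
- apply/subsetP => _ /imsetP[A AZ ->]; have := Zh _ AZ; by rewrite inE => /andP[].
Qed.

Lemma sum_hit : (#|K| * \sum_(g in Aut) #|hit g| = #|S| * (#|Aut| * #|Y|))%N.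
Proof.
have -> : \sum_(g in Aut) #|hit g| = \sum_(A in S) \sum_(g in Aut) ((g A \in Y) : nat).
  rewrite exchange_big /=; apply: eq_bigr => g _.
  by rewrite -big_mkcondr sum1_card; apply: eq_card => A; rewrite !inE.
rewrite big_distrr /= -sum_nat_const; apply: eq_bigr => A AS.
have := @sum_act_transitive _ (capdim_aut_group V) _ (fun g U => g U) K (fun U => (U \in Y) : nat) A.
move=> -> //; first 1 last.
- by move=> g h U; rewrite permM.
- by move=> g _; apply: perm_inj.
- exact: kspaces_stable.
- exact: kspaces_trans.
- exact: (subsetP SK).
rewrite -big_mkcondr sum1_card; congr (_ * _)%N; apply: eq_card => U.
by rewrite -[in RHS](setIidPr YK) inE.
Qed.

Lemma sum_degm :
  (#|K| * \sum_(g in Aut) \sum_(A in hit g) degm (g A)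
   = #|S| * (#|Aut| * \sum_(A in Y) degm A))%N.
Proof.
have -> : \sum_(g in Aut) \sum_(A in hit g) degm (g A) =
   \sum_(A in S) \sum_(g in Aut) (if g A \in Y then degm (g A) else 0)%N.
  rewrite exchange_big /=; apply: eq_bigr => g _.
  by rewrite -big_mkcondr; apply: eq_bigl => A; rewrite !inE.
rewrite big_distrr /= -sum_nat_const; apply: eq_bigr => A AS.
have := @sum_act_transitive _ (capdim_aut_group V) _ (fun g U => g U) K
  (fun U => if U \in Y then degm U else 0)%N A.
move=> -> //; first 1 last.
- by move=> g h U; rewrite permM.
- by move=> g _; apply: perm_inj.
- exact: kspaces_stable.
- exact: kspaces_trans.
- exact: (subsetP SK).
rewrite -big_mkcondr; congr (_ * _)%N; apply: eq_bigl => U.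
by case: (boolP (U \in Y)) => UY; rewrite ?andbF // andbT (subsetP YK).
Qed.

(** Ordered pairs of disjoint [k]-spaces form a single orbit, so the second moment of [#|hit g|] is
    governed by the number of such pairs in [Y]. *)
Lemma sum_hit2 : (#|dpairs K| * \sum_(g in Aut) (#|hit g| * #|hit g|.-1)
  = (#|S| * #|S|.-1) * (#|Aut| * #|dpairs Y|))%N.
Proof.
have cnt (Z : {set {vspace V}}) (f : {vspace V} -> bool) :
    (\sum_(A in Z) \sum_(B in Z :\ A) ((f A && f B) : nat)
     = #|[set A in Z | f A]| * #|[set A in Z | f A]|.-1)%N.
  rewrite -sum_nat_const [RHS]big_mkcond /= [LHS]big_mkcond; apply: eq_bigr => A _.
  rewrite inE; case: (boolP (A \in Z)) => //= AZ; case: (boolP (f A)) => fA /=; last first.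
    by rewrite big1.
  rewrite -big_mkcondr sum1_card.
  have -> : #|[set A0 in Z | f A0]|.-1 = #|[set A0 in Z | f A0] :\ A|.
    by rewrite [in LHS](cardsD1 A) inE AZ fA.
  by apply: eq_card => B; rewrite unfold_in !inE andbA.
have -> : (\sum_(g in Aut) #|hit g| * #|hit g|.-1)%N =
    \sum_(A in S) \sum_(B in S :\ A) \sum_(g in Aut) ((g A \in Y) && (g B \in Y) : nat).
  transitivity (\sum_(g in Aut) \sum_(A in S) \sum_(B in S :\ A)
                  ((g A \in Y) && (g B \in Y) : nat))%N.
    by apply: eq_bigr => g _; rewrite (cnt S (fun A => g A \in Y)).
  by rewrite exchange_big /=; apply: eq_bigr => A _; rewrite exchange_big.
have := cnt S xpredT.
have -> : [set A in S | true] = S by apply/setP => A; rewrite inE andbT.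
move=> <-; rewrite /= big_distrr big_distrl /=; apply: eq_bigr => A AS.
rewrite big_distrr big_distrl /=; apply: eq_bigr => B; rewrite !inE => /andP[BA BS].
rewrite mul1n.
have := @sum_act_transitive _ (capdim_aut_group V) _
  (fun g (p : {vspace V} * {vspace V}) => (g p.1, g p.2)) (dpairs K)
  (fun p => ((p.1 \in Y) && (p.2 \in Y)) : nat) (A, B).
move=> -> //; first 1 last.
- by move=> g h p; rewrite !permM.
- by move=> g _ [? ?] [? ?] [/perm_inj-> /perm_inj->].
- move=> g [U W] gA; rewrite /dpairs !inE /= => /and3P[dU dW dUW].
  by rewrite !dim_capdim_aut // disjoint_capdim_aut // dU dW.
- move=> [U W] [U' W']; rewrite /dpairs !inE /= => /and3P[/eqP dU /eqP dW dUW] /and3P[/eqP dU' /eqP dW' dUW'].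
  have [|||g [gA gU gW]] := @capdim_aut_pair_trans _ _ U W U' W'; rewrite ?dU ?dW //.
    by move: dUW dUW'; rewrite /disjoint_spaces => /eqP-> /eqP->; rewrite !dimv0.
  by exists g => //; rewrite /= gU gW.
- have := subsetP SK A AS; have := subsetP SK B BS; rewrite /dpairs !inE /= => -> ->.
  by rewrite Sd // eq_sym.
rewrite -big_mkcondr sum1_card; congr (_ * _)%N; apply: eq_card => -[U W].
rewrite unfold_in /dpairs !inE /=.
case: (boolP (U \in Y)) => UY; case: (boolP (W \in Y)) => WY /=; rewrite ?andbF ?andbT //.
by have := subsetP YK U UY; have := subsetP YK W WY; rewrite !inE => -> ->.
Qed.

Lemma card_dpairs (Z : {set {vspace V}}) :
  (#|dpairs Z| + \sum_(A in Z) #|[set X in Z | ~~ disjoint_spaces A X]| = #|Z| ^ 2)%N.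
Proof.
have -> : #|dpairs Z| = \sum_(A in Z) #|[set X in Z | disjoint_spaces A X]|.
  rewrite -sum1_card; under [RHS]eq_bigr do rewrite -sum1_card.
  rewrite pair_big_dep /=; apply: eq_bigl => -[U W]; by rewrite !inE.
rewrite -big_split /= -mulnn -sum_nat_const; apply: eq_bigr => A _.
by rewrite -(cardsID [set X | disjoint_spaces A X] Z); congr (_ + _)%N;
   apply: eq_card => X; rewrite !inE // andbC.
Qed.

(** The constant 3/2 is chosen so that, as every member of [Y] meets the [s] hits at least once, at
    least [#|Y| / 2] members meet exactly one of them. *)
Lemma exists_good_translate : exists2 g : {perm {vspace V}}, g \in Aut &
  (#|hit g| == s) && (2 * \sum_(A in hit g) degm (g A) <= 3 * #|Y|)%N.
Proof.
apply/exists_inP; apply: contraT => /exists_inPn bad; exfalso.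
(* An inequality for all translates: those with [s] hits satisfy it because they are bad, the others
   because of the penalty term. *)
have bad' g : g \in Aut ->
    (3 * #|Y| <= 2 * \sum_(A in hit g) degm (g A) + 3 * #|Y| * (s - #|hit g|))%N.
  move=> gA; have := bad g gA; have := hit_le gA; rewrite leq_eqVlt => /orP[/eqP->|lt].
    by rewrite eqxx -ltnNge subnn muln0 addn0 => /ltnW.
  move=> _; apply: leq_trans (leq_addl _ _); rewrite leq_pmulr // subn_gt0 //.
have quad g : g \in Aut ->
    ((2 * s - 2) * #|hit g| <= #|hit g| * #|hit g|.-1 + s * s.-1)%N.
  move=> gA; have := hit_le gA; move: (#|hit g|) => w /subnK <-.
  by move: (s - w)%N => d; case: w d => [|w] [|d] /=; nia.
have Gpos : (0 < #|Aut|)%N by apply: cardG_gt0.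
have s1 := sum_hit; have s2 := sum_hit2; have s3 := sum_degm.
have dK := card_dpairs K; have dY := card_dpairs Y.
have dKle : (\sum_(A in K) #|[set X in K | ~~ disjoint_spaces A X]| <= #|K| * mt)%N.
  by rewrite -sum_nat_const; apply: leq_sum.
have b1 : (3 * #|Y| * #|Aut| + 3 * #|Y| * \sum_(g in Aut) #|hit g| <=
    2 * \sum_(g in Aut) \sum_(A in hit g) degm (g A) + 3 * #|Y| * (s * #|Aut|))%N.
  rewrite [(3 * _ * #|_|)%N]mulnC -[(s * _)%N]mulnC -!sum_nat_const !big_distrr -!big_split /=.
  apply: leq_sum => g gA; have := bad' g gA; rewrite -{2}(subnK (hit_le gA)).
  by rewrite mulnDr addnA leq_add2r.
have b2 : ((2 * s - 2) * \sum_(g in Aut) #|hit g| <=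
    \sum_(g in Aut) (#|hit g| * #|hit g|.-1) + s * s.-1 * #|Aut|)%N.
  by rewrite [(s * _ * _)%N]mulnC -sum_nat_const big_distrr -big_split /=; apply: leq_sum.
have b3 : (\sum_(g in Aut) #|hit g| <= s * #|Aut|)%N.
  by rewrite mulnC -sum_nat_const; apply: leq_sum => g /hit_le.
have degE : (\sum_(A in Y) degm A)%N = (\sum_(A in Y) #|[set X in Y | ~~ disjoint_spaces A X]|)%N by [].
rewrite degE {degE} in s3.
have S_gt0 : (0 < #|S|)%N.
  by rewrite lt0n; apply: contraTneq Y_large => ->; rewrite muln0 add0n -ltnNge; nia.
have D_ge : (#|K| ^ 2 <= #|dpairs K| + #|K| * mt)%N by rewrite -dK leq_add2l.
move: (\sum_(A in Y) _)%N s3 dY => m s3 dY.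
move: (\sum_(g in _) \sum_(A in _) _)%N s3 b1 => SM s3 b1.
move: (\sum_(g in _) (_ * _))%N s2 b2 => SW2 s2 b2.
move: (\sum_(g in _) _)%N s1 b1 b2 b3 => SW s1 b1 b2 b3.
rewrite -mulnn in dY D_ge; rewrite -mulnn in D_ge.
exact: translate_average_contra_nat s_gt1 K_gt0 S_gt0 Gpos s1 s2 s3 dY b1 b2 b3 D_ge mt_small Y_large.
Qed.

(* For [Z] a translate with [s] members in [Y], every [X] in [Y] meets a member of
   [Z], and few meet two of them; the members of [Y] meeting only [A] in [Z] pairwise
   intersect, as two disjoint ones could replace [A]. *)
Lemma EM_large_intersecting : exists C : {set {vspace V}},
  [/\ C \subset Y, intersecting_family k C & (#|Y| <= 2 * s * #|C|)%N].
Proof.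
have [g gA /andP[/eqP hs Mle]] := exists_good_translate.
pose Z := [set g A | A in hit g].
have inZ A : A \in Z -> exists2 B, B \in S & A = g B /\ A \in Y.
  by case/imsetP=> B; rewrite inE => /andP[BS BY] ->; exists B.
have ZY : Z \subset Y by apply/subsetP => A /inZ[B _ []].
have sZ : #|Z| = s by rewrite card_imset ?hs //; apply: perm_inj.
have Zd : pairwise_disjoint Z.
  move=> _ _ /inZ[A AS [-> _]] /inZ[B BS [-> _]]; rewrite (inj_eq perm_inj) => AB.
  by rewrite disjoint_capdim_aut // Sd.
have sumZ : (\sum_(A in hit g) degm (g A) = \sum_(A in Z) degm A)%N.
  by rewrite big_imset //= => A B _ _; apply: perm_inj.
rewrite sumZ in Mle.
pose Fam A := [set X in Y | ~~ disjoint_spaces A X & [forall B in Z :\ A, disjoint_spaces B X]].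
have FI A : A \in Z -> intersecting_family k (Fam A).
  move=> AZ; split=> [X|X X']; rewrite !inE; first by case/andP=> /(proj1 YEM).
  case/and3P=> XY _ /forall_inP XZ /and3P[XY' _ /forall_inP XZ'] XX'.
  apply/negP => dXX'; case: (proj2 YEM); exists (X |: (X' |: (Z :\ A))).
  have d' : {in Z :\ A, forall U, disjoint_spaces X' U}.
    by move=> U /XZ'; rewrite disjoint_spacesC.
  have d : {in X' |: (Z :\ A), forall U, disjoint_spaces X U}.
    by move=> U /setU1P[->|/XZ] //; rewrite disjoint_spacesC.
  split; last first.
  - apply: pairwise_disjointU1 d; apply: pairwise_disjointU1 d'.
    by move=> U W /setD1P[_ UZ] /setD1P[_ WZ]; apply: Zd.
  - rewrite !cardsU1 (notin_disjoint k_gt0 (proj1 YEM _ XY) d).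
    rewrite (notin_disjoint k_gt0 (proj1 YEM _ XY') d').
    by move: sZ; rewrite (cardsD1 A) AZ => <-.
  - by rewrite !subUset !sub1set XY XY' (subset_trans (subsetDl _ _) ZY).
have two X : X \in Y ->
    (2 <= \sum_(A in Z) (~~ disjoint_spaces A X : nat) + \sum_(A in Z) (X \in Fam A : nat))%N.
  move=> XY; have [A AZ AX] := EM_meet k_gt0 YEM ZY Zd sZ XY.
  have [/existsP[B /andP[BZA BX]]|] := boolP [exists B in Z :\ A, ~~ disjoint_spaces B X].
    rewrite (bigD1 A) //= AX (bigD1 B) /=; last by move: BZA; rewrite !inE andbC.
    by rewrite BX addnCA addnA.
  move/exists_inPn => nB; rewrite (bigD1 A) //= AX [X in (_ <= _ + X)%N](bigD1 A) //=.
  have -> : X \in Fam A; last by rewrite addnACA.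
  by rewrite !inE XY AX; apply/forall_inP => B /nB/negPn.
have dbl : (2 * #|Y| <= \sum_(A in Z) degm A + \sum_(A in Z) #|Fam A|)%N.
  have -> : (\sum_(A in Z) degm A = \sum_(X in Y) \sum_(A in Z) (~~ disjoint_spaces A X : nat))%N.
    rewrite exchange_big; apply: eq_bigr => A _; rewrite -big_mkcondr.
    by rewrite /degm -sum1_card; apply: eq_bigl => X; rewrite inE.
  have -> : (\sum_(A in Z) #|Fam A| = \sum_(X in Y) \sum_(A in Z) (X \in Fam A : nat))%N.
    rewrite exchange_big; apply: eq_bigr => A _; rewrite -big_mkcondr.
    by rewrite -sum1_card; apply: eq_bigl => X; rewrite !inE; case: (X \in Y).
  by rewrite -big_split mulnC -sum_nat_const; apply: leq_sum.
have big : (#|Y| <= 2 * \sum_(A in Z) #|Fam A|)%N by move: Mle dbl; lia.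
have [/exists_inP[A AZ YA]|] := boolP [exists A in Z, (#|Y| <= 2 * s * #|Fam A|)%N].
  exists (Fam A); split=> //; last exact: FI.
  by apply/subsetP => X; rewrite inE => /andP[].
move/exists_inPn => small; exfalso.
have : (\sum_(A in Z) (2 * s * #|Fam A|) < \sum_(A in Z) #|Y|)%N.
  have [A AZ] : exists A, A \in Z by apply/set0Pn; rewrite -card_gt0 sZ; lia.
  rewrite (bigD1 A) //= [X in (_ < X)%N](bigD1 A) //= -addSn leq_add //.
    by rewrite ltnNge small.
  by apply: leq_sum => B /andP[BZ _]; rewrite ltnW // ltnNge small.
rewrite sum_nat_const sZ -big_distrr /= ltnNge => /negP; apply.
by rewrite [(2 * s)%N]mulnC -mulnA leq_mul2l big orbT.
Qed.

End LargeIntersecting.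

(** * Spreads from field extensions *)

Section Graphs.

Variables (F : finFieldType) (L : fieldExtType F) (vT : vectType F).
Variables (e1 e2 : 'Hom(L, vT)) (T : {vspace L}).
Hypothesis e12_direct : forall x y, x \in T -> e1 x + e2 y = 0 -> x = 0 /\ y = 0.

(** The line of slope [a] in the plane [L * L], embedded by [e1] and [e2] and restricted to first
    coordinates in [T]. A proper subspace [T] serves when [L] has larger degree than the spaces
    wanted. *)
Definition graph (a : L) : {vspace vT} := ((e1 + (e2 \o amull a)) @: T)%VS.

Lemma graphP a w : reflect (exists2 x, x \in T & w = e1 x + e2 (a * x)) (w \in graph a).
Proof.
apply: (iffP memv_imgP) => -[x xT ->]; exists x => //.
  by rewrite add_lfunE comp_lfunE lfunE.
by rewrite add_lfunE comp_lfunE lfunE.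
Qed.

Lemma e12_inj x y x' y' : x \in T -> x' \in T ->
  e1 x + e2 y = e1 x' + e2 y' -> x = x' /\ y = y'.
Proof.
move=> xT xT' e; have [||] := @e12_direct (x - x') (y - y'); first exact: rpredB.
  by rewrite !linearB addrACA -opprD e subrr.
by move/eqP; rewrite subr_eq0 => /eqP-> /eqP; rewrite subr_eq0 => /eqP->.
Qed.

Lemma dim_graph a : \dim (graph a) = \dim T.
Proof.
apply: limg_dim_eq; apply/eqP; rewrite -subv0; apply/subvP => x.
rewrite memv_cap memv_ker memv0 add_lfunE comp_lfunE => /andP[xT /eqP] /(e12_direct xT)[-> _].
by [].
Qed.

Lemma graph_disjoint a b : a != b -> disjoint_spaces (graph a) (graph b).
Proof.
move=> ab; rewrite /disjoint_spaces -subv0; apply/subvP => w; rewrite memv_cap memv0.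
case/andP=> /graphP[x xT ->] /graphP[y yT] /(e12_inj xT yT)[-> /eqP].
rewrite -subr_eq0 -mulrBl mulf_eq0 subr_eq0 (negPf ab) /= => /eqP->.
by rewrite mulr0 !linear0 addr0.
Qed.

Lemma graph_cap_limg a : (graph a :&: limg e2 = 0)%VS.
Proof.
apply/eqP; rewrite -subv0; apply/subvP => w; rewrite memv_cap memv0.
case/andP=> /graphP[x xT ->] /memv_imgP[y _ e].
have [|-> _] := @e12_direct x (a * x - y) xT; last by rewrite mulr0 !linear0 addr0.
by rewrite linearB /= addrA e subrr.
Qed.

Lemma graph_inj : (0 < \dim T)%N -> injective graph.
Proof.
move=> T0 a b ab; apply/eqP; apply: contraTT T0 => /graph_disjoint.
by rewrite ab /disjoint_spaces capvv -dimv_eq0 dim_graph lt0n negbK.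
Qed.

End Graphs.

Section SpreadExistence.

Variables (F : finFieldType) (vT : vectType F).
Local Notation q := #|F|.

Lemma subspace_exists (vU : vectType F) (D : {vspace vU}) (d : nat) : (d <= \dim D)%N ->
  exists2 U : {vspace vU}, (U <= D)%VS & \dim U = d.
Proof.
move=> dD; exists <<take d (vbasis D)>>%VS.
  by apply/span_subvP => x /mem_take; apply: vbasis_mem.
have fr : free (take d (vbasis D)).
  by apply: (catl_free (Y := drop d (vbasis D))); rewrite cat_take_drop (basis_free (vbasisP _)).
by rewrite (eqP fr) size_takel // size_tuple.
Qed.

Lemma embed_exists (vU : vectType F) (T : {vspace vU}) (D : {vspace vT}) :
  \dim T = \dim D ->
  exists e : 'Hom(vU, vT), (e @: T = D)%VS /\ {in T &, injective e}.
Proof.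
move=> dTD; have [f fP] := linear_of_free (vbasis T) (vbasis D).
have im : (linfun f @: T = D)%VS.
  rewrite -{1}(span_basis (vbasisP T)) -[RHS](span_basis (vbasisP D)) limg_span.
  rewrite -fP ?(basis_free (vbasisP _)) ?size_tuple //.
  by congr (<< _ >>)%VS; apply: eq_map => x; rewrite lfunE.
exists (linfun f); split=> // x y xT yT /eqP; rewrite -subr_eq0 -linearB -memv_ker => xyk.
have := limg_ker_dim (linfun f) T; rewrite im -dTD => /eqP.
rewrite -{2}[\dim T]add0n eqn_add2r dimv_eq0 => /eqP cap0.
apply/eqP; rewrite -subr_eq0 -memv0 -cap0 memv_cap xyk andbT.
exact: rpredB.
Qed.

Lemma direct_sum_eq0 (vU : vectType F) (T T' : {vspace vU}) (e1 e2 : 'Hom(vU, vT)) :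
  (e1 @: T :&: e2 @: T' = 0)%VS -> {in T &, injective e1} -> {in T' &, injective e2} ->
  forall x y, x \in T -> y \in T' -> e1 x + e2 y = 0 -> x = 0 /\ y = 0.
Proof.
move=> cap i1 i2 x y xT yT e.
have x0 : e1 x = 0.
  apply/eqP; rewrite -memv0 -cap memv_cap memv_img //=.
  have -> : e1 x = e2 (- y) by apply/eqP; rewrite linearN -addr_eq0 e.
  by rewrite memv_img ?rpredN.
have y0 : e2 y = 0 by rewrite x0 add0r in e.
by split; [apply: i1 | apply: i2]; rewrite ?mem0v ?linear0.
Qed.

(** [D] is split as [U + E] with [\dim U = k], and [E] is identified with a field [L]. The graphs
    over a [k]-dimensional [T] in [L], one for each slope, are disjoint from each other and from
    [E]; the construction continues inside [E] and ends with one [k]-space in dimension [k + r]. The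
    inequality says that at most [q ^ (k + r)] vectors, zero included, are not nonzero vectors of
    some member. *)
Lemma partial_spread_exists (k r m : nat) (D : {vspace vT}) :
  (0 < k)%N -> \dim D = (m.+1 * k + r)%N ->
  exists S : {set {vspace vT}},
    [/\ {in S, forall U, \dim U = k /\ (U <= D)%VS}, pairwise_disjoint S
      & (q ^ \dim D + #|S| <= #|S| * q ^ k + q ^ (k + r))%N].
Proof.
move=> k0; elim: m D => [|m IH] D dD.
  have [|U UD dU] := @subspace_exists _ D k; first by rewrite dD mul1n leq_addr.
  exists [set U]; split; first by move=> W /set1P->.
    by move=> W W' /set1P-> /set1P->; rewrite eqxx.
  by rewrite dD cards1 !mul1n addnC leq_add2r expn_gt0 ltnW // finNzRing_gt1.
have [|U UD dU] := @subspace_exists _ D k; first by rewrite dD mulSn -addnA leq_addr.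
pose E := (D :\: U)%VS.
have dE : \dim E = (m.+1 * k + r)%N.
  by have := dimv_cap_compl D U; rewrite (capv_idPr UD) dU dD mulSn -addnA => /addnI.
have [S [SP Sd cS]] := IH E dE.
have dE0 : (0 < \dim E)%N by rewrite dE mulSn -addnA ltn_addr.
have [L dL] := finField_ext_exists F dE0.
have [|T _ dT] := @subspace_exists _ {:L}%VS k; first by rewrite dL dE mulSn -addnA leq_addr.
have [e1 [im1 inj1]] := @embed_exists L T U (etrans dT (esym dU)).
have [e2 [im2 inj2]] := @embed_exists L fullv E dL.
have dir x y : x \in T -> e1 x + e2 y = 0 -> x = 0 /\ y = 0.
  move=> xT; apply: direct_sum_eq0 xT (memvf _) => //.
  by rewrite im1 im2 capvC capv_diff.
pose gr (a : finvect_type L) := graph e1 e2 T a.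
have gr_inj : injective gr by apply: graph_inj dir _; rewrite dT.
have gr_cap a : (gr a :&: E = 0)%VS by rewrite -im2 (graph_cap_limg dir).
have gr_S a : gr a \notin S.
  apply/negP => /SP[_ /capv_idPl]; rewrite gr_cap => g0.
  by have := dim_graph dir a; rewrite -/(gr a) -g0 dimv0 dT => k00; rewrite -k00 in k0.
exists (gr @: setT :|: S); split.
- move=> W /setUP[/imsetP[a _ ->]|WS]; last first.
    have [dW WE] := SP _ WS; split=> //; exact: subv_trans WE (diffvSl _ _).
  split; first by rewrite (dim_graph dir).
  apply/subvP => w /graphP[x xT ->]; rewrite rpredD //.
    by apply: (subvP UD); rewrite -im1 memv_img.
  by apply: (subvP (diffvSl D U)); rewrite -/E -im2 memv_img ?memvf.
- have grSd a W : W \in S -> disjoint_spaces (gr a) W.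
    move=> WS; have [_ WE] := SP _ WS; rewrite /disjoint_spaces -subv0 -(gr_cap a).
    exact: capvS.
  move=> U1 U2 /setUP[/imsetP[a _ ->]|WS] /setUP[/imsetP[b _ ->]|WS'].
  + by rewrite (inj_eq gr_inj) => ab; apply: graph_disjoint.
  + by move=> _; apply: grSd.
  + by move=> _; rewrite disjoint_spacesC grSd.
  + exact: Sd.
- have -> : #|gr @: setT :|: S| = (q ^ \dim E + #|S|)%N.
    rewrite cardsU card_imset // cardsT.
    have -> : (gr @: setT) :&: S = set0.
      by apply/setP => W; rewrite !inE; apply/negP => /andP[/imsetP[a _ ->]]; rewrite (negPf (gr_S a)).
    rewrite cards0 subn0; congr (_ + _)%N.
    have := @card_vspace F (finvect_type L) _ {:finvect_type L}.
    by rewrite card_vspacef => ->; congr (_ ^ _)%N.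
  have -> : \dim D = (\dim E + k)%N by rewrite dD dE mulSn; lia.
  by rewrite expnD mulnDl -addnA leq_add2l.
Qed.

End SpreadExistence.

(** * Density bounds *)

Lemma subn_double n k : (2 * k <= n)%N -> (n - k = (n - 2 * k) + k)%N.
Proof.
by lia.
Qed.

Section Density.

Variables (F : finFieldType) (n k : nat).
Local Notation V := 'rV[F]_n.
Local Notation q := #|F|.
Local Notation K := (kspaces F n k).
Implicit Types (U W A B X T : {vspace V}) (C : {set {vspace V}}).
Hypotheses (k_gt0 : (0 < k)%N) (n_ge : (2 * k <= n)%N).

Let k_le_n : (k <= n)%N. Proof. by apply: leq_trans n_ge; rewrite leq_pmull. Qed.

Lemma above_leq C U : C \subset K -> (#|above C U| <= #|above K U|)%N.
Proof.
move=> CK; apply/subset_leq_card/subsetP => X; rewrite !(in_set (fun _ => _ && _)).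
by case/andP=> /(subsetP CK)-> ->.
Qed.

(* Each step from [U] to [U + <[x]>], [x] in [A], multiplies the number of choices
   by [q ^ k] at most, is counted [w] times and costs a factor [q ^ (n - k)] in
   the number of [k]-spaces above. *)
Lemma above_density C t w : C \subset K ->
  (forall U, (\dim U < t)%N -> exists2 A, \dim A = k & forall X, X \in above C U ->
     (w <= #|[set x in (X :&: A)%VS | x \notin U]|)%N) ->
  forall U, (\dim U <= t)%N ->
  (#|above C U| * (w * q ^ (n - 2 * k)) ^ (t - \dim U) <= #|above K U|)%N.
Proof.
move=> CK wP U; move Ed: (t - \dim U)%N => d; elim: d U Ed => [|d IH] U Ed Ut.
  by rewrite expn0 muln1 above_leq.
have Ult : (\dim U < t)%N by rewrite -subn_gt0 Ed.
have [A dA AP] := wP U Ult.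
have dd : (t - (\dim U).+1 = d)%N by rewrite subnS Ed.
have bP x : x \in A -> x \notin U ->
    (#|above C (U + <[x]>)| * ((w * q ^ (n - 2 * k)) ^ d * q ^ (n - k)) <= #|above K U|)%N.
  move=> _ xU; rewrite mulnA.
  apply: leq_trans (above_step_le k_le_n xU); rewrite leq_mul2r IH ?orbT ?dim_add_line //.
have le := above_step AP bP.
rewrite (subn_double n_ge) in le; rewrite -(leq_pmul2r (expq_gt0 F k)).
apply: (@leq_trans (#|[set x in A | x \notin U]| * #|above K U|)).
  apply: leq_trans le; rewrite expnS expnD; apply: eq_leq; ring.
rewrite mulnC leq_mul2l -dA -card_subspace; apply/orP; right.
by apply/subset_leq_card/subsetP => x; rewrite !inE => /andP[].
Qed.

Lemma card_meet_ge U W : (\dim W < \dim U)%N ->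
  ((q - 1) * q ^ (\dim U).-1 <= #|[set x in U | x \notin W]|)%N.
Proof.
move=> WU; apply: leq_trans (card_subspaceD_ge _ _).
case: (\dim U) WU => // d; rewrite ltnS /= => Wd.
by rewrite mulnBl mul1n -expnS leq_sub2l // leq_exp2l ?q_gt1.
Qed.

(** [above_density] with [A = B] at every step: while [\dim U < i], the [i]-space [X :&: B] keeps at
    least [(q - 1) * q ^ i.-1] vectors outside [U]. *)
Lemma card_type_bound B i : (0 < i)%N -> \dim B = k ->
  (#|[set X in K | \dim (X :&: B) == i]| *
     ((q - 1) * q ^ i.-1 * q ^ (n - 2 * k)) ^ i <= #|K|)%N.
Proof.
move=> i0 dB; set C := [set X in K | _].
have := @above_density C i ((q - 1) * q ^ i.-1)%N _ _ 0%VS.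
rewrite dimv0 subn0 !above0; apply => //.
  by apply/subsetP => X; rewrite inE => /andP[].
move=> U Ui; exists B => // X; rewrite !inE -andbA => /and3P[_ /eqP dXB _].
by rewrite -dXB card_meet_ge // dXB.
Qed.

Lemma card_meet_through x A : \dim A = k -> x \notin A ->
  ((q - 1) * #|[set X in above K <[x]> | ~~ disjoint_spaces X A]| * q ^ (n - k) <=
   (q ^ k - 1) * #|above K <[x]>|)%N.
Proof.
move=> dA xA; set C := [set X in above K _ | _].
have CE : above C <[x]> = C.
  apply/setP => X; rewrite [in LHS]inE; case: (boolP (X \in C)) => //.
  by rewrite !inE -andbA => /and3P[_ -> _].
have cap0 : (A :&: <[x]> = 0)%VS.
  apply/eqP; rewrite -subv0; apply/subvP => y; rewrite memv_cap memv0.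
  case/andP=> yA /vlineP[c Dy]; have [c0|c0] := eqVneq c 0; first by rewrite Dy c0 scale0r.
  by case/negP: xA; rewrite -(scalerK c0 x) -Dy rpredZ.
have wP X : X \in above C <[x]> ->
    (q - 1 <= #|[set y in (X :&: A)%VS | y \notin <[x]>%VS]|)%N.
  rewrite CE; rewrite !inE -andbA /disjoint_spaces -dimv_eq0 -lt0n => /and3P[_ xX dXA].
  have [y yXA] : exists2 y, y \in (X :&: A)%VS & y != 0.
    by exists (vpick (X :&: A)); rewrite ?memv_pick ?vpick0 -?dimv_eq0 -?lt0n.
  (* As [x] is not in [A], no nonzero vector of [X :&: A] lies in [<[x]>], so all nonzero multiples
     of [y] count. *)
  move=> y0; have -> : (q - 1 = #|[set z in <[y]>%VS | z != 0%R]|)%N.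
    by rewrite card_subspaceD0 dim_vline y0 expn1.
  apply/subset_leq_card/subsetP => z; rewrite !inE => /andP[zy z0].
  have zXA : z \in (X :&: A)%VS by apply: subvP zy; rewrite -memvE.
  rewrite zXA; apply: contra z0 => zx; rewrite -memv0 -cap0 memv_cap zx andbT.
  by move: zXA; rewrite memv_cap => /andP[].
have bP y : y \in A -> y \notin <[x]>%VS ->
    (#|above C (<[x]> + <[y]>)| * q ^ (n - k) <= #|above K <[x]>|)%N.
  move=> yA yx; have CK : C \subset K.
    by apply/subsetP => X; rewrite !inE -andbA => /and3P[].
  apply: leq_trans (above_step_le k_le_n yx); rewrite leq_mul2r.
  by rewrite above_leq // orbT.
have := above_step wP bP; rewrite CE => le; apply: leq_trans le _; rewrite leq_mul2r -dA -card_subspaceD0; apply/orP; right.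
apply/subset_leq_card/subsetP => y; rewrite !inE => /andP[-> yx]; apply: contraNneq yx => ->.
exact: mem0v.
Qed.

Lemma card_meet A x : \dim A = k -> x != 0 ->
  ((q - 1) * #|[set X in K | ~~ disjoint_spaces A X]| <= (q ^ k - 1) * #|above K <[x]>|)%N.
Proof.
move=> dA x0; set C := [set X in K | _].
have wP X : X \in above C 0 -> (q - 1 <= #|[set y in (X :&: A)%VS | y \notin 0%VS]|)%N.
  rewrite above0 !inE disjoint_spacesC /disjoint_spaces -dimv_eq0 -lt0n => /andP[_ dXA].
  have := @card_meet_ge (X :&: A)%VS 0%VS; rewrite dimv0 => /(_ dXA); apply: leq_trans.
  by rewrite leq_pmulr ?expq_gt0.
have bP y : y \in A -> y \notin 0%VS -> (#|above C (0 + <[y]>)| * 1 <= #|above K <[x]>|)%N.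
  move=> _; rewrite memv0 add0v => y0; rewrite muln1.
  rewrite (@card_above_dim _ _ _ <[x]>%VS <[y]>%VS); last by rewrite !dim_vline x0 y0.
  by apply: above_leq; apply/subsetP => X; rewrite inE => /andP[].
have := above_step wP bP; rewrite above0 muln1 => le; apply: leq_trans le _; rewrite leq_mul2r -dA -card_subspaceD0; apply/orP; right.
by apply/subset_leq_card/subsetP => y; rewrite !inE memv0.
Qed.

(* [t] is the least dimension of a subspace meeting every member of [C]: a subspace
   of smaller dimension misses some member of [C], so [above_density] applies. *)
Lemma intersecting_cover_bound C x : intersecting_family k C -> C != set0 -> x != 0 ->
  exists t T, [/\ (0 < t)%N, \dim T = t, {in C, forall X, ~~ disjoint_spaces X T} &
    ((q - 1) * #|C| * ((q - 1) * q ^ (n - 2 * k)) ^ t.-1 <= q ^ t * #|above K <[x]>|)%N].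
Proof.
move=> CI C0 x0; have CK := intersecting_kspaces CI.
pose cov t := [exists T : {vspace V}, (\dim T == t) &&
  [forall X in C, ~~ disjoint_spaces X T]].
have [A AC] : exists A, A \in C by apply/set0Pn.
have ex : exists t, cov t.
  exists k; apply/existsP; exists A; rewrite (proj1 CI _ AC) eqxx.
  apply/forall_inP => X XC; exact: intersecting_meet k_gt0 CI XC AC.
case: (ex_minnP ex) => t /existsP[T /andP[/eqP dT /forall_inP TP]] tmin.
have t0 : (0 < t)%N.
  rewrite lt0n; apply: contraTneq (TP _ AC) => t0; rewrite negbK.
  have -> : T = 0%VS by apply/eqP; rewrite -dimv_eq0 dT t0.
  by rewrite /disjoint_spaces capv0.
exists t, T; split=> //.
have dens := @above_density C t (q - 1) CK.
have {}dens U : (\dim U <= t)%N ->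
    (#|above C U| * ((q - 1) * q ^ (n - 2 * k)) ^ (t - \dim U) <= #|above K U|)%N.
  apply: dens => W Wt.
  (* Minimality of [t] gives a member [B] missing [W]; the members of [C] above [W] meet [B],
     necessarily outside [W]. *)
  have [B BC BW] : exists2 B, B \in C & disjoint_spaces B W.
    apply/exists_inP; apply: contraTT Wt => /exists_inPn nB; rewrite -leqNgt.
    by apply: tmin; apply/existsP; exists W; rewrite eqxx; apply/forall_inP.
  exists B; first exact: proj1 CI _ BC.
  move=> X; rewrite inE => /andP[XC WX].
  have XB := intersecting_meet k_gt0 CI XC BC.
  have := @card_meet_ge (X :&: B)%VS 0%VS; rewrite dimv0 lt0n dimv_eq0 => /(_ XB).
  move=> le; apply: leq_trans (leq_trans _ le) _; first by rewrite leq_pmulr ?expq_gt0.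
  apply/subset_leq_card/subsetP => y; rewrite !inE => /andP[yXB]; rewrite yXB.
  apply: contra => yW; move: BW; rewrite /disjoint_spaces => /eqP BW; rewrite memv0.
  rewrite -memv0 -BW memv_cap yW andbT.
  by move: yXB; rewrite memv_cap => /andP[].
(* The first vector is chosen in [T], at a cost of [q ^ t] instead of [q ^ k]; the other [t.-1] are
   chosen in members of [C]. *)
have wP X : X \in above C 0 -> (q - 1 <= #|[set y in (X :&: T)%VS | y \notin 0%VS]|)%N.
  rewrite above0 => XC; have := TP X XC; rewrite /disjoint_spaces -dimv_eq0 -lt0n => dXT.
  have := @card_meet_ge (X :&: T)%VS 0%VS; rewrite dimv0 => /(_ dXT); apply: leq_trans.
  by rewrite leq_pmulr ?expq_gt0.
have bP y : y \in T -> y \notin 0%VS ->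
    (#|above C (0 + <[y]>)| * ((q - 1) * q ^ (n - 2 * k)) ^ t.-1 <= #|above K <[x]>|)%N.
  move=> _; rewrite memv0 add0v => y0.
  rewrite (@card_above_dim _ _ _ <[x]>%VS <[y]>%VS); last by rewrite !dim_vline x0 y0.
  by have := dens <[y]>%VS; rewrite dim_vline y0 [(t - _)%N]subn1 => /(_ t0).
have := above_step wP bP; rewrite above0 => le; apply: leq_trans le _; rewrite leq_mul2r -dT -card_subspace; apply/orP; right.
by apply/subset_leq_card/subsetP => y; rewrite !inE => /andP[].
Qed.

End Density.

(** * Partial spreads meeting given subspaces in prescribed dimensions *)

Section PowerSpaces.

Variables (F : finFieldType) (L : splittingFieldType F).

Lemma finField_ext_generator : exists z : L, <<1; z>>%VS = fullv.
Proof.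
pose Fm := FinFieldExtType L.
have /cyclicP[g gP] := field_unit_group_cyclic [set: {unit Fm}]%G.
exists (val g : Fm); apply/eqP; rewrite eqEsubv subvf /=; apply/subvP => x _.
have [->|x0] := eqVneq x 0; first by rewrite mem0v.
have /cycleP[i xi] : FinRing.unit Fm (etrans (unitfE (x : Fm)) x0) \in <[g]>%g by rewrite -gP inE.
have -> : x = (val g : Fm) ^+ i by rewrite -FinRing.val_unitX -xi.
by rewrite rpredX ?memv_adjoin.
Qed.

Definition powers (z : L) d := [seq z ^+ j | j <- iota 0 d].

Lemma powers_free z d : <<1; z>>%VS = fullv -> (d <= \dim {:L})%N -> free (powers z d).
Proof.
move=> gen dL.
have dimL : adjoin_degree 1 z = \dim {:L}.
  by have := dim_Fadjoin 1 z; rewrite gen dimv1 muln1.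
have full : free (powers z (\dim {:L})).
  apply: (@basis_free _ _ fullv); rewrite basisEdim size_map size_iota leqnn andbT -gen.
  rewrite Fadjoin_eq_sum; apply/subv_sumP => i _; rewrite prod1v -memvE memv_span //.
  apply/mapP; exists (val i) => //; by rewrite mem_iota add0n -Fadjoin_eq_sum gen -dimL ltn_ord.
move: full; have -> : powers z (\dim {:L}) = powers z d ++ drop d (powers z (\dim {:L})).
  by rewrite -{1}(cat_take_drop d (powers z _)) -map_take take_iota (minn_idPl dL).
exact: catl_free.
Qed.

(** Polynomials in [z] of degree below [d1] and below [d2] have a product of degree below
    [d1 + d2 - 1]. The guard admits [d1 = 0], where [a = 0]; this occurs when the truncated
    [k.+1 - 2 * i] is zero. *)
Lemma powers_mul z d1 d2 d3 a b : ((0 < d1)%N -> (d1 + d2 <= d3.+1)%N) ->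
  a \in <<powers z d1>>%VS -> b \in <<powers z d2>>%VS -> a * b \in <<powers z d3>>%VS.
Proof.
move=> d123 aP bP; have mono i : (i < d1)%N -> z ^+ i * b \in <<powers z d3>>%VS.
  move=> id1; have : amull (z ^+ i) b \in (amull (z ^+ i) @: <<powers z d2>>)%VS by exact: memv_img.
  rewrite lfunE /= limg_span; apply: subvP; apply/span_subvP => _ /mapP[_ /mapP[j jd ->] ->].
  rewrite lfunE /= -exprD memv_span //; apply/mapP; exists (i + j)%N => //.
  by move: jd; have := d123 (leq_ltn_trans (leq0n i) id1); rewrite !mem_iota /=; lia.
have : amulr b a \in (amulr b @: <<powers z d1>>)%VS by exact: memv_img.
rewrite lfunE /= limg_span; apply: subvP; apply/span_subvP => _ /mapP[_ /mapP[j jd ->] ->].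
by rewrite lfunE /= mono //; move: jd; rewrite mem_iota.
Qed.

End PowerSpaces.

Section Configurations.

Variables (F : finFieldType) (n k : nat).
Local Notation V := 'rV[F]_n.
Local Notation q := #|F|.
Hypotheses (k_gt0 : (0 < k)%N) (n_eq : n = (2 * k)%N).

(* [V] is identified with the plane [L * L] over the field [L] of degree [k]; the
   lines [y = a * x] of this plane form a partial spread. *)
Lemma plane_model : exists (L : splittingFieldType F) (e1 e2 : 'Hom(L, V)),
  \dim {:L} = k /\ forall x y, e1 x + e2 y = 0 -> x = 0 /\ y = 0.
Proof.
have [L dL] := finField_ext_exists F k_gt0.
have [|U _ dU] := @subspace_exists F V {:V}%VS k; first by rewrite dim_rVf n_eq; lia.
have dUC : \dim (U^C)%VS = k by rewrite dimv_compl dim_rVf dU; move: n_eq; lia.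
have [e1 [im1 inj1]] := @embed_exists F V L {:L}%VS U (etrans dL (esym dU)).
have [e2 [im2 inj2]] := @embed_exists F V L {:L}%VS (U^C)%VS (etrans dL (esym dUC)).
exists L, e1, e2; split=> // x y; apply: (direct_sum_eq0 _ inj1 inj2); rewrite ?memvf //.
by rewrite im1 im2 capv_compl.
Qed.

(* With [P d] the span of [1, z, ..., z ^ d.-1], the line [y = a * x] meets
   [B := P i * P (k - i)] exactly in the points with [x] in [P i] when [a] is in
   [P (k.+1 - 2 * i)]; for [k.+1 < 2 * i] only [a = 0] remains. *)
Lemma type_config i : (0 < i <= k)%N ->
  exists (B : {vspace V}) (S : {set {vspace V}}), [/\ \dim B = k, pairwise_disjoint S,
    {in S, forall X, \dim X = k /\ \dim (X :&: B) = i} & (q ^ (k.+1 - 2 * i) <= #|S|)%N].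
Proof.
case/andP=> i0 ik; have [L [e1 [e2 [dL dir]]]] := plane_model.
have dirT (T : {vspace L}) x y : x \in T -> e1 x + e2 y = 0 -> x = 0 /\ y = 0.
  by move=> _; apply: dir.
have [z gen] := finField_ext_generator L.
pose P d := <<powers z d>>%VS.
have dP d : (d <= k)%N -> \dim (P d) = d.
  by rewrite -dL => /(powers_free gen)/eqP ->; rewrite size_map size_iota.
have ker1 : lker e1 = 0%VS.
  apply/eqP; rewrite -subv0; apply/subvP => x; rewrite memv_ker memv0 => /eqP e.
  by have [|->] := dir x 0; rewrite ?linear0 ?addr0.
have ker2 : lker e2 = 0%VS.
  apply/eqP; rewrite -subv0; apply/subvP => x; rewrite memv_ker memv0 => /eqP e.
  by have [|_ ->] := dir 0 x; rewrite ?linear0 ?add0r.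
pose gr (a : finvect_type L) := graph e1 e2 {:L}%VS a.
have gr_inj : injective gr by apply: graph_inj (dirT _) _; rewrite dL.
exists (e1 @: P i + e2 @: P (k - i)%N)%VS, (gr @: [set a : finvect_type L | (a : L) \in P (k.+1 - 2 * i)%N]); split.
- rewrite dimv_disjoint_sum ?limg_dim_eq ?ker1 ?ker2 ?capv0 // ?dP ?leq_subr ?subnKC //.
  apply/eqP; rewrite -subv0; apply/subvP => w; rewrite memv_cap memv0.
  case/andP=> /memv_imgP[x _ ->] /memv_imgP[y _ e].
  by have [|->] := dir x (- y); rewrite ?linear0 // linearN /= e subrr.
- by move=> _ _ /imsetP[a _ ->] /imsetP[b _ ->]; rewrite (inj_eq gr_inj) => ab; apply: (@graph_disjoint _ _ _ e1 e2 fullv (dirT _) a b ab).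
- move=> X /imsetP[a]; rewrite inE => aP ->; split; first by rewrite (dim_graph (dirT _)).
  have -> : (gr a :&: (e1 @: P i + e2 @: P (k - i)%N) = graph e1 e2 (P i) a)%VS.
    apply/eqP; rewrite eqEsubv; apply/andP; split; apply/subvP => w.
      rewrite memv_cap => /andP[/graphP[x _ ->]].
      case/memv_addP=> _ /memv_imgP[s sP ->] [_ /memv_imgP[u _ ->]].
      case/(e12_inj (dirT _) (memvf _) (memvf _)) => -> _; by apply/graphP; exists s.
    case/graphP=> x xP ->; rewrite memv_cap; apply/andP; split.
      by apply/graphP; exists x; rewrite ?memvf.
    rewrite memv_add ?memv_img //; have ax := powers_mul _ aP xP.
    by apply: ax; move: i0 ik; lia.
  by rewrite (dim_graph (dirT _)) dP.
- rewrite card_imset // cardsE (@card_vspace F (finvect_type L)).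
  by rewrite leq_exp2l ?q_gt1 // -/(P _) dP //; lia.
Qed.

(* [B] is the graph of the Frobenius map and [B' := w B] with [w] outside [F]: the
   lines [y = u ^ q.-1 * x] meet [B] in [F u], hence also [B'], since they are
   invariant under multiplication by [w]. *)
Lemma cross_config : (1 < k)%N ->
  exists (B B' : {vspace V}) (S : {set {vspace V}}),
  [/\ \dim B = k, \dim B' = k, disjoint_spaces B B', pairwise_disjoint S &
      {in S, forall X, [/\ \dim X = k, \dim (X :&: B) = 1%N & \dim (X :&: B') = 1%N]} /\
      (q ^ k - 1 <= #|S| * (q - 1))%N].
Proof.
move=> k1; have [L [e1 [e2 [dL dir]]]] := plane_model.
have dirT (T : {vspace L}) x y : x \in T -> e1 x + e2 y = 0 -> x = 0 /\ y = 0.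
  by move=> _; apply: dir.
have e12 x y x' y' : e1 x + e2 y = e1 x' + e2 y' -> x = x' /\ y = y'.
  exact: (e12_inj (dirT fullv) (memvf _) (memvf _)).
have fixF (x : L) : x ^+ q = x -> x \in (1%VS : {vspace L}).
  move=> xq; have := Fermat's_little_theorem (1%AS : {subfield L}) x.
  by rewrite dimv1 expn1 xq eqxx.
have [alpha _ aP] := finField_galois_generator (sub1v {:L}%AS).
pose fr : 'End(L) := alpha.
have frE x : fr x = x ^+ q by rewrite /fr aP ?memvf // dimv1 expn1.
have [w _ w1] : exists2 w, w \in {:L}%VS & w \notin (1%VS : {vspace L}).
  apply/subvPn; apply/negP => /dimvS; rewrite dL dimv1 leqNgt => /negP; exact.
have w0 : w != 0 by apply: contraNneq w1 => ->; rewrite mem0v.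
pose B := ((e1 + (e2 \o fr)) @: fullv)%VS.
pose B' := ((e1 \o amull w + (e2 \o (amull w \o fr))) @: fullv)%VS.
have BP v : reflect (exists x, v = e1 x + e2 (x ^+ q)) (v \in B).
  apply: (iffP memv_imgP) => [[x _ ->]|[x ->]]; exists x; rewrite ?memvf //.
    by rewrite add_lfunE comp_lfunE frE.
  by rewrite add_lfunE comp_lfunE frE.
have B'P v : reflect (exists x, v = e1 (w * x) + e2 (w * x ^+ q)) (v \in B').
  apply: (iffP memv_imgP) => [[x _ ->]|[x ->]]; exists x; rewrite ?memvf //.
    by rewrite add_lfunE !comp_lfunE !lfunE /= frE.
  by rewrite add_lfunE !comp_lfunE !lfunE /= frE.
have dB : \dim B = k.
  rewrite limg_dim_eq //; apply/eqP; rewrite -subv0; apply/subvP => x.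
  by rewrite memv_cap memv_ker memv0 add_lfunE comp_lfunE => /andP[_ /eqP/dir[-> _]].
have dB' : \dim B' = k.
  rewrite limg_dim_eq //; apply/eqP; rewrite -subv0; apply/subvP => x.
  rewrite memv_cap memv_ker memv0 add_lfunE !comp_lfunE !lfunE /= => /andP[_ /eqP/dir[/eqP]].
  by rewrite mulf_eq0 (negPf w0).
have q_gt0 : (0 < q)%N by rewrite ltnW ?q_gt1.
have zq : (0 : L) ^+ q = 0 by rewrite expr0n gtn_eqF.
pose slope u : L := u ^+ q / u.
have slopeP u y : u != 0 -> slope u * y = y ^+ q -> exists c, y = c *: u.
  move=> u0 e; have /fixF/vlineP[c yu] : (y / u) ^+ q = y / u.
    by rewrite expr_div_n -e /slope; field; rewrite expf_neq0 ?u0.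
  by exists c; rewrite -[u]mul1r scalerAl -yu divfK.
have line u y : u != 0 -> y != 0 ->
    \dim <[(e1 y + e2 (slope u * y))%R]>%VS = 1%N.
  move=> u0 y0; rewrite dim_vline; case: eqP => // /dir[y00 _].
  by rewrite y00 eqxx in y0.
have capB u : u != 0 ->
    (graph e1 e2 fullv (slope u) :&: B = <[(e1 u + e2 (slope u * u))%R]>)%VS.
  move=> u0; apply/eqP; rewrite eqEsubv; apply/andP; split; last first.
    rewrite -memvE memv_cap; apply/andP; split; first by apply/graphP; exists u; rewrite ?memvf.
    by apply/BP; exists u; rewrite /slope divfK.
  apply/subvP => v; rewrite memv_cap => /andP[/graphP[x _ ->] /BP[y /e12[-> e]]].
  have [c ->] := slopeP _ _ u0 e; apply/vlineP; exists c.
  by rewrite -scalerAr !linearZ /= scalerDr.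
have capB' u : u != 0 ->
    (graph e1 e2 fullv (slope u) :&: B' = <[(e1 (w * u) + e2 (slope u * (w * u)))%R]>)%VS.
  move=> u0; apply/eqP; rewrite eqEsubv; apply/andP; split; last first.
    rewrite -memvE memv_cap; apply/andP; split.
      by apply/graphP; exists (w * u); rewrite ?memvf.
    by apply/B'P; exists u; rewrite mulrCA /slope divfK.
  apply/subvP => v; rewrite memv_cap => /andP[/graphP[x _ ->] /B'P[y /e12[-> e]]].
  have {}e : slope u * y = y ^+ q by apply: (mulfI w0); rewrite -e mulrCA.
  have [c ->] := slopeP _ _ u0 e; apply/vlineP; exists c.
  by rewrite -!scalerAr !linearZ /= scalerDr.
pose gr (a : finvect_type L) := graph e1 e2 {:L}%VS a.
pose S : {set {vspace V}} := [set gr (slope (u : L)) | u : finvect_type L in [set u : finvect_type L | (u : L) != 0]].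
exists B, B', S; split=> //.
- rewrite /disjoint_spaces -subv0; apply/subvP => v; rewrite memv_cap memv0.
  case/andP=> /BP[y ->] /B'P[x /e12[-> /eqP]].
  (* A common vector has [y = w * x] and [y ^+ q = w * x ^+ q], so either [w ^+ q = w], which puts
     [w] in [F], or [x = 0]. *)
  rewrite exprMn -subr_eq0 -mulrBl mulf_eq0 subr_eq0 expf_eq0 q_gt0 /=.
  case/orP=> [/eqP/fixF wF|/eqP->]; first by rewrite wF in w1.
  by rewrite zq !mulr0 !linear0 addr0.
- move=> U1 U2 /imsetP[u _ ->] /imsetP[u' _ ->] neq.
  apply: (@graph_disjoint _ _ _ e1 e2 fullv (dirT _)).
  by apply: contraNneq neq => ->.
split.
  move=> X /imsetP[u]; rewrite inE => u0 ->; rewrite /gr capB // capB' //.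
  by rewrite !line ?mulf_neq0 // (dim_graph (dirT _)).
(* The members of [S] cover the nonzero vectors of [B], and each contains only [q - 1] of them. *)
have -> : (q ^ k - 1 = #|[set v in B | v != 0%R]|)%N by rewrite card_subspaceD0 dB.
apply: (@leq_trans (\sum_(X in S) #|[set v in (X :&: B)%VS | v != 0%R]|)%N).
  have -> : (\sum_(X in S) #|[set v in (X :&: B)%VS | v != 0%R]| =
      \sum_(v in [set v in B | v != 0%R]) \sum_(X in S) (v \in X : nat))%N.
    rewrite exchange_big; apply: eq_bigr => X _; rewrite -big_mkcondr -sum1_card.
    by apply: eq_bigl => v; rewrite !inE memv_cap; case: (v \in X); rewrite ?andbF ?andbT.
  rewrite -sum1_card; apply: leq_sum => v; rewrite inE => /andP[/BP[y ->] v0].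
  have y0 : y != 0 by apply: contraNneq v0 => ->; rewrite zq !linear0 addr0.
  rewrite (bigD1 (gr (slope y))) /=; last by apply/imsetP; exists y => //; rewrite inE.
  suff -> : e1 y + e2 (y ^+ q) \in gr (slope y) by [].
  by apply/graphP; exists y; rewrite ?memvf // /slope divfK.
rewrite -sum_nat_const; apply: leq_sum => X /imsetP[u]; rewrite inE => u0 ->.
by rewrite card_subspaceD0 /gr capB // line // expn1.
Qed.

End Configurations.

(** * Two disjoint [k]-spaces cannot both meet a large intersecting family *)

Section Dichotomy.

Variables (F : finFieldType) (n k : nat).
Local Notation V := 'rV[F]_n.
Local Notation q := #|F|.
Local Notation K := (kspaces F n k).
Implicit Types (U W A B X T : {vspace V}) (C S : {set {vspace V}}) (i : nat).
Hypothesis k_gt0 : (0 < k)%N.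

Definition type_class B i : {set {vspace V}} := [set X in K | \dim (X :&: B) == i].

Definition cross_class B B' : {set {vspace V}} :=
  [set X in K | (\dim (X :&: B) == 1%N) && (\dim (X :&: B') == 1%N)].

Lemma pairwise_disjoint_aut (s : {perm {vspace V}}) S : s \in capdim_aut V ->
  pairwise_disjoint S -> pairwise_disjoint [set s X | X in S].
Proof.
move=> sA Sd _ _ /imsetP[X XS ->] /imsetP[Y YS ->]; rewrite (inj_eq perm_inj) => XY.
by rewrite disjoint_capdim_aut // Sd.
Qed.

(** The configuration is moved onto the given [B]. The stabilizer of [B] is transitive on
    [type_class B i], so [transitive_packing] applies to this class. *)
Lemma type_packing C B i : n = (2 * k)%N -> (0 < i <= k)%N -> \dim B = k ->
  intersecting_family k C ->
  (#|C :&: type_class B i| * q ^ (k.+1 - 2 * i) <= #|type_class B i|)%N.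
Proof.
move=> n2k ik dB CI; have [B0 [S [dB0 Sd SP cS]]] := type_config F k_gt0 n2k ik.
have [|||s [sA sB _]] := @capdim_aut_pair_trans F V B0 B0 B B; rewrite ?capvv ?dB0 ?dB //.
have cap X : \dim (s X :&: B) = \dim (X :&: B0) by rewrite -sB; apply: (capdim_autP _ sA).
have sS : [set s X | X in S] \subset type_class B i.
  apply/subsetP => _ /imsetP[X XS ->]; have [dX dXB] := SP _ XS.
  by rewrite !inE cap dim_capdim_aut // dX dXB !eqxx.
have := @transitive_packing _ _ k (stab2_group B B) (type_class B i) _ C _ _ _ sS
  (pairwise_disjoint_aut sA Sd) CI.
rewrite card_imset; last exact: perm_inj.
move=> pack; apply: leq_trans (pack _ _ _); first by rewrite leq_mul2l cS orbT.
- by apply/subsetP => g /stab2P[].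
- move=> g X /stab2P[gA gB _]; rewrite !inE dim_capdim_aut //.
  by rewrite -{2}gB (capdim_autP _ gA).
- move=> X Y; rewrite !inE => /andP[/eqP dX /eqP dXB] /andP[/eqP dY /eqP dYB].
  have [|||g [gA gX gB]] := @capdim_aut_pair_trans F V X B Y B; rewrite ?dX ?dXB //.
  by exists g => //; apply/stab2P.
Qed.

Lemma cross_packing C B B' : n = (2 * k)%N -> (1 < k)%N -> \dim B = k -> \dim B' = k ->
  disjoint_spaces B B' -> intersecting_family k C ->
  (#|C :&: cross_class B B'| * (q ^ k - 1) <= #|cross_class B B'| * (q - 1))%N.
Proof.
move=> n2k k1 dB dB' dBB' CI.
have [B0 [B0' [S [dB0 dB0' dBB0 Sd [SP cS]]]]] := cross_config F k_gt0 n2k k1.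
have [|||s [sA sB sB']] := @capdim_aut_pair_trans F V B0 B0' B B'; rewrite ?dB0 ?dB0' ?dB ?dB' //.
  by move: dBB' dBB0; rewrite /disjoint_spaces => /eqP-> /eqP->; rewrite !dimv0.
have cap X : \dim (s X :&: B) = \dim (X :&: B0) by rewrite -sB; apply: (capdim_autP _ sA).
have cap' X : \dim (s X :&: B') = \dim (X :&: B0') by rewrite -sB'; apply: (capdim_autP _ sA).
have sS : [set s X | X in S] \subset cross_class B B'.
  apply/subsetP => _ /imsetP[X XS ->]; have [dX dXB dXB'] := SP _ XS.
  by rewrite !inE cap cap' dim_capdim_aut // dX dXB dXB' !eqxx.
have := @transitive_packing _ _ k (stab2_group B B') (cross_class B B') _ C _ _ _ sS
  (pairwise_disjoint_aut sA Sd) CI.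
rewrite card_imset; last exact: perm_inj.
move=> pack; apply: (@leq_trans (#|C :&: cross_class B B'| * (#|S| * (q - 1)))).
  by rewrite leq_mul2l cS orbT.
rewrite mulnA leq_mul2r pack ?orbT //.
- by apply/subsetP => g /stab2P[].
- move=> g X /stab2P[gA gB gB']; rewrite !inE dim_capdim_aut //.
  by rewrite -{2}gB -{2}gB' !(capdim_autP _ gA).
- move=> X Y; rewrite !inE => /and3P[/eqP dX /eqP dXB /eqP dXB'] /and3P[/eqP dY /eqP dYB /eqP dYB'].
  have capB : (B :&: B' = 0)%VS by apply/eqP.
  have addB : (B + B' = fullv)%VS.
    apply/eqP; rewrite eqEdim subvf /= dim_rVf dimv_disjoint_sum // dB dB'.
    by move: n2k; lia.
  have [g [gA gB gB' gX]] := capdim_aut_cross_trans capB addB dB dB' dX dXB dXB' dY dYB dYB'.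
  by exists g => //; apply/stab2P.
Qed.

Hypothesis n_ge : (2 * k <= n)%N.

(** A point of [X :&: B] is chosen first; it lies outside [B'], so [card_meet_through] bounds the
    members through it that meet [B']. *)
Lemma cross_class_bound B B' x : \dim B = k -> \dim B' = k -> disjoint_spaces B B' -> x != 0 ->
  ((q - 1) * #|cross_class B B'| * ((q - 1) * q ^ (n - k)) <=
    (q ^ k - 1) * ((q ^ k - 1) * #|above K <[x]>|))%N.
Proof.
move=> dB dB' dBB' x0; set O := cross_class B B'.
have wP X : X \in above O 0 -> (q - 1 <= #|[set y in (X :&: B)%VS | y \notin 0%VS]|)%N.
  rewrite above0 inE => /and3P[_ /eqP dXB _].
  by rewrite card_subspaceD ?sub0v // dXB dimv0 expn1.
have bP y : y \in B -> y \notin 0%VS ->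
    (#|above O (0 + <[y]>)| * ((q - 1) * q ^ (n - k)) <= (q ^ k - 1) * #|above K <[x]>|)%N.
  rewrite memv0 add0v => yB y0.
  rewrite (@card_above_dim _ _ _ <[x]>%VS <[y]>%VS); last by rewrite !dim_vline x0 y0.
  have yB' : y \notin B'.
    apply: contra y0 => yB'; move: dBB'; rewrite /disjoint_spaces => /eqP BB'.
    by rewrite -memv0 -BB' memv_cap yB.
  apply: leq_trans (card_meet_through n_ge dB' yB'); rewrite mulnA leq_mul2r; apply/orP; right.
  rewrite mulnC leq_mul2l; apply/orP; right; apply/subset_leq_card/subsetP => X.
  rewrite !inE => /andP[/and3P[-> _ /eqP dXB'] ->].
  by rewrite /disjoint_spaces -dimv_eq0 dXB'.
have := above_step wP bP; rewrite above0 => le; apply: leq_trans le _.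
by rewrite leq_mul2r card_subspaceD ?sub0v // dB dimv0 expn0 leqnn orbT.
Qed.

Lemma card_kspaces_double x : n = (2 * k)%N -> x != 0 ->
  #|K| = (#|above K <[x]>| * (q ^ k + 1))%N.
Proof.
move=> n2k x0; have := above_line_rec k x0.
have -> : (q ^ n = q ^ k * q ^ k)%N by rewrite -expnD n2k mul2n addnn.
have q1 : (0 < q ^ k - 1)%N by rewrite subn_gt0 -(expn0 q) ltn_exp2l ?q_gt1.
have -> : (q ^ k * q ^ k - 1 = (q ^ k - 1) * (q ^ k + 1))%N by rewrite mulnn -subn_sqr.
by move/eqP; rewrite -mulnA eqn_pmul2l // => /eqP ->; rewrite mulnC.
Qed.

(** Density of the class and packing inside it combine to about [c * q / (q - 1) ^ i], with [c] the
    number of [k]-spaces through a point. This is of order [c / q] at [i = 2] but would exceed [c]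
    at [i = 1], which is why point intersections go through [cross_class]. *)
Lemma type_class_packing C B i x : n = (2 * k)%N -> (2 <= i <= k)%N -> \dim B = k ->
  intersecting_family k C -> x != 0 ->
  (#|C :&: type_class B i| * (q ^ k.-1 * (q - 1) ^ i) <= #|above K <[x]>| * (q ^ k + 1))%N.
Proof.
move=> n2k /andP[i2 ik] dB CI x0; rewrite -card_kspaces_double //.
have i0 : (0 < i)%N by apply: leq_trans i2.
have := @card_type_bound F n k n_ge B i i0 dB; apply: leq_trans.
have -> : (n - 2 * k = 0)%N by rewrite n2k subnn.
rewrite expn0 muln1.
have pack := @type_packing C B i n2k _ dB CI; rewrite i0 ik in pack.
apply: leq_trans (leq_mul (pack isT) (leqnn _)).
rewrite -mulnA leq_mul2l; apply/orP; right.
rewrite expnMn [X in (_ <= X)%N]mulnCA mulnC leq_mul2l; apply/orP; right.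
rewrite -expnM -expnD leq_exp2l ?q_gt1 //.
(* Over the integers, [(i - 1) * i + (k + 1 - 2 * i)] exceeds [k - 1] by [(i - 1) * (i - 2)];
   truncated subtraction only helps. *)
have : ((i - 1) * (i - 2) + 2 * i = i.-1 * i + 2)%N.
  by case: i i2 {i0 ik pack} => [|[|i]] // _; rewrite /= !subSS !subn0; lia.
by move: ik i2; lia.
Qed.

Lemma meet_both_le C B B' : C \subset K ->
  (#|[set X in C | ~~ disjoint_spaces X B & ~~ disjoint_spaces X B']| <=
    #|C :&: cross_class B B'| + \sum_(2 <= i < k.+1)
      (#|C :&: type_class B i| + #|C :&: type_class B' i|))%N.
Proof.
move=> CK; have cardE (A : {set {vspace V}}) : #|C :&: A| = (\sum_(X in C) (X \in A : nat))%N.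
  by rewrite -big_mkcondr -sum1_card; apply: eq_bigl => X; rewrite inE.
have -> : [set X in C | ~~ disjoint_spaces X B & ~~ disjoint_spaces X B'] =
    C :&: [set X | ~~ disjoint_spaces X B & ~~ disjoint_spaces X B'].
  by apply/setP => X; rewrite !inE.
rewrite !cardE (eq_bigr _ (fun i _ => congr2 addn (cardE _) (cardE _))).
rewrite big_split /= ![(\sum_(2 <= i < k.+1) _)%N]exchange_big /= -!big_split /=.
apply: leq_sum => X XC; have XK := subsetP CK X XC.
have dX : \dim X = k by move: XK; rewrite inE => /eqP.
have typeE A : (1 < \dim (X :&: A))%N ->
    (0 < \sum_(2 <= i < k.+1) (X \in type_class A i : nat))%N.
  move=> dXA; rewrite (bigD1_seq (\dim (X :&: A))) ?iota_uniq //=; last first.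
    by rewrite mem_index_iota dXA ltnS -dX dimvS ?capvSl.
  suff -> : X \in type_class A (\dim (X :&: A)) by [].
  by rewrite !inE dX !eqxx.
rewrite [in X in (X <= _)%N]inE; case: andP => //= -[].
rewrite /disjoint_spaces -!dimv_eq0 -!lt0n => dXB dXB'.
have [/typeE d|dB1] := ltnP 1 (\dim (X :&: B)).
  by rewrite addn_gt0 addn_gt0 d orbT.
have [/typeE d|dB1'] := ltnP 1 (\dim (X :&: B')).
  by rewrite addn_gt0 addn_gt0 d !orbT.
have -> : X \in cross_class B B' by rewrite !inE dX eqxx !eqn_leq dB1 dB1' dXB dXB'.
by [].
Qed.

End Dichotomy.

Lemma geometric_tail (R : realFieldType) (Q : R) m : 2 < Q ->
  \sum_(2 <= i < m.+1) (Q - 1)^-1 ^+ i <= ((Q - 1) * (Q - 2))^-1.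
Proof.
move=> Q2; set y := (Q - 1)^-1.
have y0 : 0 <= y by rewrite invr_ge0; lra.
have -> : ((Q - 1) * (Q - 2))^-1 = y ^+ 2 / (1 - y).
  by rewrite /y; field; repeat (apply/andP; split); rewrite gt_eqF //; lra.
have y1 : y < 1 by rewrite invf_lt1; lra.
rewrite ler_pdivlMr; last by lra.
have [m1|m1] := leqP m 0.
  by rewrite big_geq ?mul0r ?sqr_ge0 //; move: m1; lia.
suff -> : (\sum_(2 <= i < m.+1) y ^+ i) * (1 - y) = y ^+ 2 - y ^+ m.+1.
  by rewrite gerBl exprn_ge0.
rewrite -(subnKC m1) add1n; elim: (m - 1)%N => [|d IH].
  by rewrite big_geq // mul0r subrr.
by rewrite big_nat_recr //= mulrDl IH (exprS y (1 + d).+1) mulrBr mulr1; ring.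
Qed.

(** The first term is at most [32/31 * c / Q] and the tail at most [33/16 * 512/465 * c / Q], where
    [512/465] is the value of [Q ^+ 2 / ((Q - 1) * (Q - 2))] at [Q = 32]. Their sum is below
    [7/2 * c / Q], so [s * M <= 7/32 * c]. *)
Lemma double_numeric (R : realFieldType) (Q s c M : R) m :
  32 <= Q -> 2 <= s -> 16 * s <= Q -> 0 < c ->
  M <= c / (Q - 1) + 2 * \sum_(2 <= i < m.+1) (33 / 32 * c * Q * (Q - 1)^-1 ^+ i) ->
  s * M < 15 / 32 * c.
Proof.
move=> Q32 s2 sQ c0; rewrite -big_distrr /= => MP.
have Q2 : 2 < Q by lra.
have tail := geometric_tail m Q2.
have {}MP : M <= c * ((Q - 1)^-1 + 33 / 16 * (Q * ((Q - 1) * (Q - 2))^-1)).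
  apply: le_trans MP _; rewrite mulrDr lerD2l.
  have -> : c * (33 / 16 * (Q * ((Q - 1) * (Q - 2))^-1)) =
    2 * (33 / 32 * c * Q * ((Q - 1) * (Q - 2))^-1) by field; lra.
  by rewrite ler_pM2l // ler_wpM2l // mulr_ge0 ?mulr_ge0 //; lra.
have i1 : (Q - 1)^-1 <= 32 / 31 * Q^-1.
  rewrite ler_pdivlMr; last by lra.
  by rewrite mulrC ler_pdivrMr; lra.
have i2 : Q * ((Q - 1) * (Q - 2))^-1 <= 512 / 465 * Q^-1.
  rewrite ler_pdivlMr; last by lra.
  rewrite mulrAC ler_pdivrMr; last by rewrite mulr_gt0 //; lra.
  nra.
have Qi : 0 < Q^-1 by rewrite invr_gt0; lra.
have {}MP : M <= c * (7 / 2 * Q^-1).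
  by apply: le_trans MP _; rewrite ler_pM2l //; lra.
have sQi : s * Q^-1 <= 16^-1.
  by rewrite ler_pdivrMr; lra.
have : s * M <= c * (7 / 2 * (s * Q^-1)).
  apply: (@le_trans _ _ (s * (c * (7 / 2 * Q^-1)))); first by rewrite ler_pM2l //; lra.
  by rewrite le_eqVlt; apply/orP; left; apply/eqP; ring.
have : c * (7 / 2 * (s * Q^-1)) <= c * (7 / 32) by rewrite ler_pM2l //; lra.
nra.
Qed.

(** Square roots are taken after [q <= 2 * (q - 1)] and [q ^ a <= (q ^ a) ^ 2]. Squares in the
    hypothesis avoid half-integral exponents. *)
Lemma small_mul_le (q s a : nat) : (1 < q)%N -> ((16 * s) ^ 2 <= q ^ a.+2)%N ->
  (8 * s <= (q - 1) * q ^ a)%N.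
Proof.
move=> q1 ss; have h : (q ^ 2 <= (2 * (q - 1)) ^ 2)%N by rewrite leq_sqr; lia.
have : ((16 * s) ^ 2 <= (2 * ((q - 1) * q ^ a)) ^ 2)%N.
  apply: leq_trans ss _; apply: (@leq_trans (q ^ 2 * (q ^ a) ^ 2)).
    by rewrite -expnM -expnD leq_exp2l //; lia.
  by rewrite mulnA [(_ ^ 2)%N in X in (_ <= X)%N]expnMn leq_mul2r h orbT.
by rewrite leq_sqr; lia.
Qed.

Lemma type_numeric (R : realFieldType) (N c Q P D : R) :
  32 <= Q -> 1 <= P -> 0 < D -> 0 <= c -> N * (P * D) <= c * (Q * P + 1) ->
  N <= 33 / 32 * c * Q / D.
Proof.
move=> Q32 P1 D0 c0 le; have P0 : 0 < P by lra.
rewrite ler_pdivlMr // -(ler_pM2r P0); apply: le_trans (_ : c * (Q * P + 1) <= _).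
  by have -> : N * D * P = N * (P * D) by ring.
have -> : 33 / 32 * c * Q * P = c * (33 / 32 * (Q * P)) by ring.
rewrite ler_wpM2l //; have : 32 * 1 <= Q * P by apply: ler_pM.
lra.
Qed.

(** For [Q = q] and [P = q ^ k], the packing factor [(P - 1) / (Q - 1)] cancels one of the two
    numbers of points in the bound for the class [O]. *)
Lemma cross_numeric (R : realFieldType) (N O c Q P : R) :
  1 < Q -> 1 < P -> 0 <= c -> N * (P - 1) <= O * (Q - 1) ->
  (Q - 1) * O * ((Q - 1) * P) <= (P - 1) * ((P - 1) * c) -> N <= c / (Q - 1).
Proof.
move=> Q1 P1 c0 p1 p2; have Q0 : 0 < Q - 1 by lra.
have P0 : 0 < P - 1 by lra.
have P0' : 0 < P by lra.
rewrite ler_pdivlMr // -(ler_pM2r P0) -(ler_pM2r P0').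
apply: le_trans (_ : (Q - 1) * O * ((Q - 1) * P) <= _).
  have -> : N * (Q - 1) * (P - 1) * P = N * (P - 1) * ((Q - 1) * P) by ring.
  by rewrite ler_pM2r ?mulr_gt0 // mulrC [X in _ <= X]mulrC mulrC.
apply: le_trans p2 _.
have -> : c * (P - 1) * P = (P - 1) * (P * c) by ring.
by rewrite ler_pM2l // ler_wpM2r //; lra.
Qed.

Section DichotomyMain.

Variables (F : finFieldType) (n k s : nat).
Local Notation V := 'rV[F]_n.
Local Notation q := #|F|.
Local Notation K := (kspaces F n k).
Implicit Types (U W A B X T : {vspace V}) (C S : {set {vspace V}}) (i : nat).
Hypotheses (k_gt0 : (0 < k)%N) (n_ge : (2 * k <= n)%N) (s_gt1 : (1 < s)%N).
Hypothesis s_small : ((16 * s) ^ 2 <= q ^ (n - 2 * k).+2)%N.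

Let k_le_n : (k <= n)%N. Proof. by apply: leq_trans n_ge; rewrite leq_pmull. Qed.

Lemma kspaces_gt0 : (0 < #|K|)%N.
Proof.
have [|U _ dU] := @subspace_exists F V {:V}%VS k; first by rewrite dim_rVf.
by rewrite card_gt0; apply/set0Pn; exists U; rewrite inE dU.
Qed.

Lemma expq_sub1_gt0 i : (0 < i)%N -> (0 < q ^ i - 1)%N.
Proof. by move=> i0; rewrite subn_gt0 -(expn0 q) ltn_exp2l ?q_gt1. Qed.

Lemma above_line_gt0 (x : V) : x != 0 -> (0 < #|above K <[x]>|)%N.
Proof.
move=> x0; have e := above_line_rec k x0.
have : (0 < (q ^ k - 1) * #|K|)%N by rewrite muln_gt0 kspaces_gt0 expq_sub1_gt0.
by rewrite e muln_gt0 => /andP[].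
Qed.

(* The members of [C] meeting [B] and [B'] meet both in dimension [1], or one of
   them in dimension at least [2]; the packing bounds handle each of these types. *)
Lemma gap_double C B B' x : n = (2 * k)%N -> intersecting_family k C ->
  \dim B = k -> \dim B' = k -> disjoint_spaces B B' -> x != 0 ->
  (15 * #|above K <[x]>| <= 32 * #|C|)%N ->
  (s * #|[set X in C | ~~ disjoint_spaces X B & ~~ disjoint_spaces X B']| < #|C|)%N.
Proof.
move=> n2k CI dB dB' dBB' x0 Cbig.
have n0 : (n - 2 * k = 0)%N by rewrite n2k subnn.
(* At [n = 2 * k] the smallness of [s] reads [16 * s <= q], and [s >= 2] then gives [q >= 32]. *)
have q16 : (16 * s <= q)%N by rewrite -leq_sqr; move: s_small; rewrite n0.
have q32 : (32 <= q)%N by move: q16 s_gt1; lia.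
set c := #|above K <[x]>| in Cbig *; have c0 : (0 < c)%N := above_line_gt0 x0.
have meet := meet_both_le B B' (intersecting_kspaces CI).
set M := #|_| in meet *.
have Q32 : 32 <= (q%:R : rat) by rewrite (ler_nat _ 32).
have q1E : ((q - 1)%N%:R : rat) = q%:R - 1 by rewrite natrB ?(ltnW (q_gt1 F)).
have Q1 : 0 < (q%:R - 1 : rat) by rewrite -q1E ltr0n subn_gt0 q_gt1.
have typeP A i : \dim A = k -> (2 <= i < k.+1)%N ->
    (#|C :&: type_class k A i|%:R : rat) <= 33 / 32 * c%:R * q%:R * (q%:R - 1)^-1 ^+ i.
  move=> dA i2k; have := type_class_packing k_gt0 n_ge n2k i2k dA CI x0.
  rewrite -/c -(ler_nat rat) !natrM natrD !natrX q1E exprVn => le.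
  have kE : (q%:R : rat) ^+ k = q%:R * q%:R ^+ k.-1 by rewrite -exprS prednK.
  rewrite kE in le; apply: type_numeric le => //; rewrite ?exprn_ege1 ?exprn_gt0 ?ler0n //.
  by rewrite (ler_nat _ 1) ltnW // q_gt1.
have crossP : (#|C :&: cross_class k B B'|%:R : rat) <= c%:R / (q%:R - 1).
  have [k1|k1] := leqP k 1.
    have -> : C :&: cross_class k B B' = set0.
      apply/setP => X; rewrite !inE; apply/negP => /and4P[_ /eqP dX /eqP dXB /eqP dXB'].
      have k1' : k = 1%N by apply/eqP; rewrite eqn_leq k1.
      have XB : (X <= B)%VS by apply/capv_idPl/eqP; rewrite eqEdim capvSl dXB dX k1'.
      have XB' : (X <= B')%VS by apply/capv_idPl/eqP; rewrite eqEdim capvSl dXB' dX k1'.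
      move: dBB'; rewrite /disjoint_spaces => /eqP BB'.
      have : (X <= 0)%VS by rewrite -BB' subv_cap XB.
      by rewrite subv0 -dimv_eq0 dX k1'.
    by rewrite cards0 divr_ge0 ?ler0n // ltW.
  have p1 := cross_packing k_gt0 n2k k1 dB dB' dBB' CI.
  have p2 := cross_class_bound n_ge dB dB' dBB' x0.
  have nk : (n - k = k)%N by rewrite n2k; lia.
  rewrite nk -/c in p2; rewrite -!(ler_nat rat) !natrM !natrX in p1 p2.
  have qkE : ((q ^ k - 1)%N%:R : rat) = q%:R ^+ k - 1 by rewrite natrB ?natrX // expq_gt0.
  rewrite !q1E !qkE in p1 p2.
  apply: cross_numeric p1 p2; rewrite ?ler0n //.
    by rewrite (ltr_nat _ 1) q_gt1.
  by rewrite -subr_gt0 -qkE ltr0n expq_sub1_gt0.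
have {meet}meetR : (M%:R : rat) <= c%:R / (q%:R - 1) +
    2 * \sum_(2 <= i < k.+1) (33 / 32 * c%:R * q%:R * (q%:R - 1)^-1 ^+ i).
  move: meet; rewrite -(ler_nat rat) natrD natr_sum => meetR; apply: le_trans meetR _.
  apply: lerD crossP _; rewrite mulr_sumr; apply: ler_sum_nat => i i2k.
  rewrite natrD mulr_natl mulr2n; apply: lerD; exact: typeP.
have s2R : 2 <= (s%:R : rat) by rewrite (ler_nat _ 2).
have q16R : 16 * (s%:R : rat) <= q%:R by rewrite -natrM ler_nat.
have c0R : 0 < (c%:R : rat) by rewrite ltr0n.
have num := double_numeric Q32 s2R q16R c0R meetR.
rewrite -(ltr_nat rat) natrM; apply: lt_le_trans num _.
rewrite mulrAC ler_pdivrMr; last by rewrite ltr0n.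
by rewrite [_ * 32]mulrC -!natrM ler_nat.
Qed.

(** The constant 1024 is [(16 * 2) ^ 2]. As [Q <= 2 * (Q - 1)], the left side is at most
    [128 * (Q - 1) ^ 2], so [Q ^ a >= 11] suffices; for [Q <= 10] this follows from
    [1024 > 10 * 100]. *)
Lemma large_arith a (Q := q) : (0 < a)%N -> (1024 <= Q ^ a.+2)%N ->
  (32 * Q ^ 2 < 15 * ((Q - 1) ^ 2 * Q ^ a))%N /\ (Q <= (Q - 1) * Q ^ a)%N.
Proof.
move=> a0 Qa; have Q1 : (1 < Q)%N := q_gt1 F.
have Qa_ge : (Q <= Q ^ a)%N by rewrite -{1}(expn1 Q) leq_exp2l.
have Qa11 : (11 <= Q ^ a)%N.
  have [Q11|Q11] := leqP 11 Q; first exact: leq_trans Qa_ge.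
  by move: Qa; rewrite 2!expnS; nia.
split; nia.
Qed.

(* Here the family [C] is a point pencil: otherwise every subspace meeting all its
   members has dimension at least [2], and [C] is too small. *)
Lemma gap_large C B B' x : (2 * k < n)%N -> intersecting_family k C ->
  \dim B = k -> \dim B' = k -> disjoint_spaces B B' -> x != 0 ->
  (15 * #|above K <[x]>| <= 32 * #|C|)%N ->
  (s * #|[set X in C | ~~ disjoint_spaces X B & ~~ disjoint_spaces X B']| < #|C|)%N.
Proof.
move=> n2k CI dB dB' dBB' x0 Cbig.
set c := #|above K <[x]>| in Cbig *; have c0 : (0 < c)%N := above_line_gt0 x0.
have C0 : (0 < #|C|)%N by move: Cbig c0; lia.
have ss := s_small; set a := (n - 2 * k)%N in ss *; have a0 : (0 < a)%N by rewrite subn_gt0.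
have Qa : (1024 <= q ^ a.+2)%N by apply: leq_trans ss; move: s_gt1; nia.
have [ar1 ar2] := large_arith a0 Qa.
have [|t [T [t0 dT TP bnd]]] := intersecting_cover_bound k_gt0 n_ge CI _ x0.
  by rewrite -card_gt0.
rewrite -/c -/a in bnd; have q1 : (0 < q - 1)%N by rewrite subn_gt0 q_gt1.
(* Each dimension beyond the second costs a factor [q] and gains [(q - 1) * q ^ a >= q], so [t = 2]
   is the worst case, and it contradicts [Cbig]. *)
have t1 : t = 1%N.
  apply/eqP; rewrite eqn_leq t0 andbT leqNgt; apply/negP => t2.
  have pw : (q ^ (t - 2) <= ((q - 1) * q ^ a) ^ (t - 2))%N.
    by case: (t - 2)%N => // d; rewrite leq_exp2r.
  have tE2 : (t = (t - 2).+2)%N by rewrite -addn2 subnK.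
  have tE : (t.-1 = (t - 2).+1)%N by rewrite {1}tE2.
  have b2 : ((q - 1) ^ 2 * q ^ a * #|C| <= q ^ 2 * c)%N.
    rewrite -(leq_pmul2r (expq_gt0 F (t - 2))).
    apply: (@leq_trans ((q - 1) * #|C| * ((q - 1) * q ^ a) ^ t.-1)).
      rewrite tE (expnS _ (t - 2)); apply: (@leq_trans ((q - 1) * #|C| * ((q - 1) * q ^ a * q ^ (t - 2)))).
        by apply: eq_leq; ring.
      by rewrite leq_mul2l leq_mul2l pw !orbT.
    by apply: leq_trans bnd _; rewrite {1}tE2 !expnS; apply: eq_leq; ring.
  have : (15 * ((q - 1) ^ 2 * q ^ a) * #|C| <= 32 * q ^ 2 * #|C|)%N.
    apply: (@leq_trans (15 * (q ^ 2 * c))); [by rewrite -mulnA leq_mul2l b2 orbT |].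
    by rewrite mulnCA [(32 * _)%N]mulnC -mulnA leq_mul2l Cbig orbT.
  by rewrite leq_pmul2r // leqNgt ar1.
have [y y0 TE] := dim1_line (etrans dT t1).
have yC X : X \in C -> (<[y]> <= X)%VS.
  move/TP; rewrite TE /disjoint_spaces => Xy.
  have [v vXy v0] : exists2 v, v \in (X :&: <[y]>)%VS & v != 0.
    by exists (vpick (X :&: <[y]>)); rewrite ?memv_pick ?vpick0.
  move: vXy; rewrite memv_cap => /andP[vX /vlineP[d Dv]].
  have d0 : d != 0 by apply: contraNneq v0 => d0; rewrite Dv d0 scale0r.
  by rewrite -memvE -(scalerK d0 y) -Dv rpredZ.
have main A : \dim A = k -> y \notin A ->
    (s * #|[set X in C | ~~ disjoint_spaces X A]| < #|C|)%N.
  move=> dA yA; have := card_meet_through n_ge dA yA.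
  rewrite (@card_above_dim _ _ _ <[y]>%VS <[x]>%VS); last by rewrite !dim_vline x0 y0.
  rewrite -/c; set M := #|_| => le.
  have MM : (#|[set X in C | ~~ disjoint_spaces X A]| <= M)%N.
    apply/subset_leq_card/subsetP => X; rewrite 3!inE => /andP[XC ->].
    by rewrite (subsetP (intersecting_kspaces CI)) ?yC.
  apply: leq_ltn_trans (leq_mul (leqnn s) MM) _.
  have nk : (n - k = a + k)%N := subn_double n_ge.
  have {}le : ((q - 1) * q ^ a * M <= c)%N.
    rewrite -(leq_pmul2r (expq_gt0 F k)).
    apply: (@leq_trans ((q - 1) * M * q ^ (n - k))); first by rewrite nk expnD; apply: eq_leq; ring.
    by apply: leq_trans le _; rewrite mulnC leq_mul2l leq_subr orbT.
  have sD : (32 * s < 15 * ((q - 1) * q ^ a))%N.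
    have D0 : (0 < (q - 1) * q ^ a)%N by rewrite muln_gt0 q1 expq_gt0.
    by have := small_mul_le (q_gt1 F) ss; move: D0; lia.
  have [->|M0] := posnP M; first by rewrite muln0.
  rewrite -(ltn_pmul2l (_ : 0 < 32)%N) // mulnA; apply: leq_trans Cbig.
  apply: (@leq_trans (15 * ((q - 1) * q ^ a) * M)); first by rewrite ltn_pmul2r.
  by rewrite -mulnA leq_mul2l le.
(* The common point [y] of the members of [C] is outside [B] or outside [B'], and few members meet a
   [k]-space that avoids [y]. *)
have [yB|yB] := boolP (y \in B); last first.
  apply: leq_ltn_trans (main B dB yB); rewrite leq_mul2l; apply/orP; right.
  by apply/subset_leq_card/subsetP => X; rewrite !inE => /and3P[-> ->].
have yB' : y \notin B'.
  apply: contra y0 => yB'; move: dBB'; rewrite /disjoint_spaces => /eqP BB'.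
  by rewrite -memv0 -BB' memv_cap yB.
apply: leq_ltn_trans (main B' dB' yB'); rewrite leq_mul2l; apply/orP; right.
by apply/subset_leq_card/subsetP => X; rewrite !inE => /and3P[-> _ ->].
Qed.

Lemma gap C B B' x : intersecting_family k C ->
  \dim B = k -> \dim B' = k -> disjoint_spaces B B' -> x != 0 ->
  (15 * #|above K <[x]>| <= 32 * #|C|)%N ->
  (s * #|[set X in C | ~~ disjoint_spaces X B & ~~ disjoint_spaces X B']| < #|C|)%N.
Proof.
move: n_ge; rewrite leq_eqVlt => /orP[/eqP/esym|]; first exact: gap_double.
exact: gap_large.
Qed.

End DichotomyMain.

(** * Splitting off one intersecting family at a time *)

Section Decomposition.

Variables (F : finFieldType) (n k : nat).
Local Notation V := 'rV[F]_n.
Local Notation q := #|F|.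
Local Notation K := (kspaces F n k).
Implicit Types (U W A B X T : {vspace V}) (C Y S : {set {vspace V}}) (s t : nat).
Hypotheses (k_gt0 : (0 < k)%N) (n_ge : (2 * k <= n)%N).

Let k_le_n : (k <= n)%N. Proof. by apply: leq_trans n_ge; rewrite leq_pmull. Qed.

Lemma union_of_intersectingU t Y C Y' : intersecting_family k C ->
  union_of_intersecting k t Y' -> Y = C :|: Y' -> union_of_intersecting k t.+1 Y.
Proof.
move=> CI [P PI ->] ->.
exists (fun i => if unlift ord0 i is Some j then P j else C).
  by move=> i; case: unliftP => [j _|_].
rewrite big_ord_recl unlift_none; congr (_ :|: _).
by apply: eq_bigr => i _; rewrite liftK.
Qed.

Lemma EM_family0 Y : EM_family k 0 Y -> Y = set0.
Proof.
move=> [_ YEM]; apply/setP => A; rewrite inE; apply/negP => AY; case: YEM.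
exists [set A]; rewrite sub1set cards1; split=> // U W /set1P-> /set1P->.
by rewrite eqxx.
Qed.

Lemma EM_family1 Y : EM_family k 1 Y -> intersecting_family k Y.
Proof.
move=> [Yk YEM]; split=> // A B AY BY AB; apply/negP => dAB; case: YEM.
exists [set A; B]; split; first by rewrite subUset !sub1set AY.
  by rewrite cards2 AB.
move=> U W /set2P[]-> /set2P[]->; rewrite ?eqxx // => _.
by rewrite disjoint_spacesC.
Qed.

Lemma union_of_intersecting0 : union_of_intersecting k 0 (set0 : {set {vspace V}}).
Proof. by exists (fun=> set0) => [[]|] //; rewrite big_ord0. Qed.

Lemma above_line_intersecting x : x != 0 -> intersecting_family k (above K <[x]>).
Proof.
move=> x0; split=> [U|U W]; rewrite !inE; first by case/andP=> /eqP.
move=> /andP[_ xU] /andP[_ xW] _; apply: contra x0; rewrite /disjoint_spaces => /eqP UW.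
by rewrite -memv0 -UW memv_cap !memvE xU.
Qed.

Section Induction.

Variables (s : nat) (S : {set {vspace V}}) (x : V).
Hypotheses (s_gt1 : (1 < s)%N) (x0 : x != 0).
Hypothesis s_small : ((16 * s) ^ 2 <= q ^ (n - 2 * k).+2)%N.
Hypotheses (SK : S \subset K) (Sd : pairwise_disjoint S).
Local Notation c := #|above K <[x]>|.

Let q1 : (0 < q - 1)%N. Proof. by rewrite subn_gt0 q_gt1. Qed.

(** The bound of [card_meet], relative to [#|K|], is at most [1 / ((q - 1) * q ^ (n - 2 * k))], and
    [small_mul_le] compares this with [1 / (4 * s)]. *)
Lemma meet_proportion : exists mt : nat,
  {in K, forall A, (#|[set X in K | ~~ disjoint_spaces A X]| <= mt)%N} /\
  (4 * s * mt <= #|K|)%N.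
Proof.
pose mt := ((q ^ k - 1) * c %/ (q - 1))%N; exists mt; split.
  move=> A; rewrite inE => /eqP dA; rewrite leq_divRL // mulnC.
  exact: card_meet.
have e := above_line_rec k x0; have P0 := expq_sub1_gt0 F k_gt0.
have mtP : (mt * (q - 1) <= (q ^ k - 1) * c)%N by apply: leq_trunc_div.
have ss := s_small; set a := (n - 2 * k)%N in ss.
have nE : (q ^ n = q ^ a * (q ^ k * q ^ k))%N.
  by rewrite -!expnD /a; congr (_ ^ _)%N; move: n_ge; lia.
have sD : (4 * s <= (q - 1) * q ^ a)%N.
  by apply: leq_trans (small_mul_le (q_gt1 F) ss); rewrite leq_mul2r orbT.
have sq : (q ^ a * ((q ^ k - 1) * (q ^ k - 1)) <= q ^ n - 1)%N.
  rewrite nE; apply: (@leq_trans (q ^ a * (q ^ k * q ^ k - 1))).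
    have -> : (q ^ k * q ^ k - 1 = (q ^ k - 1) * (q ^ k + 1))%N by rewrite mulnn -subn_sqr.
    by rewrite leq_mul2l leq_mul2l (leq_trans (leq_subr _ _) (leq_addr _ _)) !orbT.
  by rewrite mulnBr muln1 leq_sub2l ?expq_gt0.
rewrite -(leq_pmul2l P0) -(leq_pmul2l q1) e.
apply: (@leq_trans (4 * s * ((q ^ k - 1) * (mt * (q - 1))))); first by apply: eq_leq; ring.
apply: (@leq_trans ((q - 1) * q ^ a * ((q ^ k - 1) * ((q ^ k - 1) * c)))).
  by apply: leq_mul => //; rewrite leq_mul2l mtP orbT.
have -> : ((q - 1) * q ^ a * ((q ^ k - 1) * ((q ^ k - 1) * c)) =
  (q - 1) * (q ^ a * ((q ^ k - 1) * (q ^ k - 1)) * c))%N by ring.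
by rewrite leq_mul2l leq_mul2r sq !orbT.
Qed.

Lemma large_intersecting t Y : (1 < t)%N -> (t <= s)%N -> EM_family k t Y ->
  (8 * t * #|K| <= 8 * #|Y| * #|S| + #|K|)%N ->
  exists C, [/\ C \subset Y, intersecting_family k C & (15 * c <= 32 * #|C|)%N].
Proof.
move=> t1 ts YEM Yl; have [mt [mtP mt_small]] := meet_proportion.
have K0 : (0 < #|K|)%N by apply: kspaces_gt0.
have mt_small' : (4 * t * mt <= #|K|)%N.
  by apply: leq_trans mt_small; rewrite leq_mul2r leq_mul2l ts !orbT.
have [C [CY CI Cl]] := EM_large_intersecting k_gt0 t1 YEM SK Sd K0 mtP mt_small' Yl.
exists C; split=> //.
have S0 : (0 < #|S|)%N.
  by rewrite lt0n; apply: contraTneq Yl => ->; rewrite muln0 add0n -ltnNge; nia.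
have cS := partial_spread_bound SK Sd (above_line_intersecting x0).
rewrite -(leq_pmul2r S0) -(leq_pmul2r (ltnW t1)).
have h1 : (15 * c * #|S| * t <= 15 * #|K| * t)%N.
  by rewrite leq_mul2r -mulnA leq_mul2l cS !orbT.
(* This is [8 * t - 1 >= 15/2 * t], true from [t = 2] on. *)
have h2 : (15 * #|K| * t <= 16 * #|Y| * #|S|)%N by nia.
have h3 : (16 * #|Y| * #|S| <= 32 * #|C| * #|S| * t)%N.
  have -> : (32 * #|C| * #|S| * t = 16 * (2 * t * #|C|) * #|S|)%N by ring.
  by rewrite leq_mul2r leq_mul2l Cl !orbT.
by apply: leq_trans h1 _; apply: leq_trans h2 _.
Qed.

(** The family split off is [P], not [C]: only members of [Y] that miss some member [A] of [C] are
    known to meet few members of [C], by comparison with [A], which meets all of them. *)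
Lemma EM_decomposition t Y : (t <= s)%N -> EM_family k t Y ->
  (8 * t * #|K| <= 8 * #|Y| * #|S| + #|K|)%N -> union_of_intersecting k t Y.
Proof.
elim: t Y => [|t IH] Y ts YEM Yl.
  by rewrite (EM_family0 YEM); apply: union_of_intersecting0.
have [t0|t0] := posnP t.
  rewrite t0 in YEM *; apply: (union_of_intersectingU (EM_family1 YEM) union_of_intersecting0).
  by rewrite setU0.
have [C [CY CI Cl]] := @large_intersecting t.+1 Y t0 ts YEM Yl.
have gapC B B' := @gap F n k s k_gt0 n_ge s_gt1 s_small C B B' x CI.
pose P := [set B in Y | [forall X in C, ~~ disjoint_spaces X B]].
have PI : intersecting_family k P.
  split=> [B|B B']; rewrite !inE; first by case/andP=> /(proj1 YEM).
  case/andP=> BY /forall_inP BC /andP[B'Y /forall_inP B'C] BB'; apply/negP => dBB'.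
  have := gapC B B' (proj1 YEM _ BY) (proj1 YEM _ B'Y) dBB' x0 Cl.
  have -> : [set X in C | ~~ disjoint_spaces X B & ~~ disjoint_spaces X B'] = C.
    by apply/setP => X; rewrite inE; case: (boolP (X \in C)) => //= XC; rewrite BC ?B'C.
  by rewrite ltnNge leq_pmull // ltnW.
have PK := partial_spread_bound SK Sd PI.
have PY : P \subset Y by apply/subsetP => X; rewrite inE => /andP[].
apply: (union_of_intersectingU PI (Y' := Y :\: P)); last first.
  by apply/setP => X; rewrite !inE; case: (X \in Y); rewrite ?andbF //= andbT orbN.
apply: IH; first exact: ltnW; last first.
  have cY : (#|Y| = #|P| + #|Y :\: P|)%N by rewrite -(cardsID P Y) (setIidPr PY).
  by move: Yl PK; rewrite cY; nia.
split=> [B|[Z [ZY sZ Zd]]]; first by rewrite inE => /andP[_ /(proj1 YEM)].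
have smallB B : B \in Z -> (s * #|[set X in C | ~~ disjoint_spaces X B]| < #|C|)%N.
  move=> BZ; have := subsetP ZY B BZ; rewrite !inE => /andP[nP BY].
  have [A AC AB] : exists2 A, A \in C & disjoint_spaces A B.
    by apply/exists_inP; move: nP; rewrite BY /= => /forall_inPn[A AC /negPn AB]; apply/exists_inP; exists A.
  have dA := proj1 CI _ AC; rewrite disjoint_spacesC in AB.
  apply: leq_ltn_trans (gapC B A (proj1 YEM _ BY) dA AB x0 Cl); rewrite leq_mul2l; apply/orP; right.
  apply/subset_leq_card/subsetP => X; rewrite !inE => /andP[XC ->].
  by rewrite XC (intersecting_meet k_gt0 CI XC AC).
(* Otherwise the members of [Z], at most [s] in number and each meeting fewer than [#|C| / s]
   members of [C], would together meet all of [C]. *)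
have [X XC XZ] : exists2 X, X \in C & {in Z, forall B, disjoint_spaces X B}.
  have [/exists_inP[X XC /forall_inP XZ]|/exists_inPn all] :=
    boolP [exists X in C, [forall B in Z, disjoint_spaces X B]]; first by exists X.
  have le1 : (#|C| <= \sum_(B in Z) #|[set X in C | ~~ disjoint_spaces X B]|)%N.
    have -> : (\sum_(B in Z) #|[set X in C | ~~ disjoint_spaces X B]| =
        \sum_(X in C) \sum_(B in Z) (~~ disjoint_spaces X B : nat))%N.
      rewrite exchange_big; apply: eq_bigr => B _; rewrite -big_mkcondr -sum1_card.
      by apply: eq_bigl => X; rewrite inE.
    rewrite -sum1_card; apply: leq_sum => X /all /forall_inPn[B BZ XB].
    by rewrite (bigD1 B) //= XB.
  have le2 : (\sum_(B in Z) (s * #|[set X in C | ~~ disjoint_spaces X B]|).+1 <= #|Z| * #|C|)%N.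
    by rewrite -sum_nat_const; apply: leq_sum => B /smallB.
  have le3 : (s * #|C| + #|Z| <= #|Z| * #|C|)%N.
    apply: leq_trans le2; under [X in (_ <= X)%N]eq_bigr do rewrite -addn1.
    by rewrite big_split /= sum1_card leq_add2r -big_distrr leq_mul2l le1 orbT.
  have le4 : (#|Z| * #|C| <= s * #|C|)%N by rewrite leq_mul2r sZ ts orbT.
  by move: le3 le4; rewrite sZ; lia.
case: (proj2 YEM); exists (X |: Z); split; last exact: pairwise_disjointU1.
  by rewrite subUset sub1set (subsetP CY) // (subset_trans ZY (subsetDl _ _)).
by rewrite cardsU1 (notin_disjoint k_gt0 (proj1 CI _ XC) XZ) sZ.
Qed.

End Induction.
End Decomposition.

(** * Gaussian coefficients and the hypotheses of the theorem *)

(** By induction on [d]: once the common power of [q] is cancelled, [above_rec] supplies the first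
    factor of the product. *)
Lemma qbinom_above (R : realType) (F : finFieldType) (n k d : nat) (U : {vspace 'rV[F]_n}) :
  (k <= n)%N -> (\dim U + d = k)%N ->
  #|above (kspaces F n k) U|%:R =
    qbinom (#|F|%:R : R) (n%:Z - (\dim U)%:Z) (k%:Z - (\dim U)%:Z).
Proof.
move=> kn; have q1 : (1 < (#|F|%:R : R)) by rewrite (ltr_nat _ 1) q_gt1.
set q := (#|F|%:R : R) in q1 *.
elim: d U => [|d IH] U dU.
  rewrite -dU addn0 subrr /qbinom /= big_ord0.
  have -> : above (kspaces F n (\dim U)) U = [set U]; last by rewrite cards1.
  apply/setP => W; rewrite !inE; apply/andP/eqP => [[/eqP dW UW]|->]; last by rewrite subvv.
  by apply/esym/eqP; rewrite eqEdim UW dW leqnn.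
have [x _ xU] : exists2 x, x \in {:'rV[F]_n}%VS & x \notin U.
  by apply/subvPn; apply/negP => /dimvS; rewrite dim_rVf; move: kn dU; lia.
have kE : k%:Z - (\dim U)%:Z = d.+1%:Z by rewrite -dU PoszD addrC addKr.
have kE' : k%:Z - (\dim U).+1%:Z = d%:Z by rewrite -dU addnS -addSn PoszD addrC addKr.
have := IH (U + <[x]>)%VS; rewrite dim_add_line // addSnnS => /(_ dU).
rewrite kE' kE /qbinom /= big_ord_recl /= !subr0 => e.
have -> : \prod_(i < d) (qnum q (n%:Z - (\dim U)%:Z - (bump 0 i)%:Z) /
    qnum q (d.+1%:Z - (bump 0 i)%:Z)) = #|above (kspaces F n k) (U + <[x]>)|%:R.
  rewrite e; apply: eq_bigr => i _; rewrite /bump /= add1n.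
  congr (qnum q _ / qnum q _); lia.
have rec := above_rec k xU.
have dk : (\dim U < k)%N by rewrite -dU -addSnnS leq_addr.
have qE m : (\dim U <= m)%N -> ((#|F| ^ m - #|F| ^ \dim U)%N%:R : R) =
    q ^+ (\dim U) * (q ^ (m%:Z - (\dim U)%:Z) - 1).
  move=> dm; rewrite natrB ?leq_exp2l ?q_gt1 // !natrX -/q.
  by rewrite subzn // mulrBr mulr1 -exprnP -exprD subnKC.
have {}rec := congr1 (fun a : nat => a%:R : R) rec.
rewrite !natrM !qE ?(ltnW dk) ?(leq_trans (ltnW dk) kn) // kE in rec.
have qd0 : q ^+ \dim U != 0 by rewrite expf_neq0 // gt_eqF //; lra.
have qk0 : q ^ d.+1%:Z - 1 != 0.
  by rewrite -exprnP gt_eqF // subr_gt0 exprn_egt1.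
have q10 : q - 1 != 0 by rewrite gt_eqF // subr_gt0.
rewrite -!mulrA in rec; have {}rec := mulfI qd0 rec.
rewrite /qnum; apply: (mulfI qk0); rewrite rec; field.
by rewrite qk0 q10.
Qed.

(** For [P = q ^ k - 1], [Q = q ^ n] and [E = q ^ (k + r)]. After multiplication by [P], the slack
    [v * P = c * (Q - 1)] pays for the imperfect spread, [8 * s * c * E <= c * Q / 2], and for the
    deficit of [Y], at most [c * Q / 32]. *)
Lemma proportion_numeric (R : realFieldType) (Y N P c v Q E s : R) :
  v * P = c * (Q - 1) -> Q - E <= N * P -> 256 * s * c <= 256 * Y + c -> 16 * s * E <= Q ->
  0 < P -> 0 < c -> 1 <= Q -> 1 <= s -> 0 <= E -> 0 <= Y -> 8 * s * v <= 8 * Y * N + v.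
Proof.
move=> vP NP Yl sE P0 c0 Q1 s1 E0 Y0.
rewrite -(ler_pM2r P0).
have -> : 8 * s * v * P = 8 * (s * (v * P)) by ring.
have -> : (8 * Y * N + v) * P = 8 * (Y * (N * P)) + v * P by ring.
rewrite vP.
have YNP : 8 * (Y * (Q - E)) <= 8 * (Y * (N * P)) by rewrite ler_pM2l // ler_wpM2l.
have QE : 0 <= Q - E by nra.
have h : (s * c - c / 256) * (Q - E) <= Y * (Q - E) by rewrite ler_wpM2r //; lra.
have h2 : c * (16 * s * E) <= c * Q by rewrite ler_wpM2l // ltW.
have h3 : c * 1 <= c * Q by rewrite ler_wpM2l // ltW.
have h4 : 0 <= c * E by rewrite mulr_ge0 // ltW.
have h5 : c * 1 <= c * s by rewrite ler_wpM2l // ltW.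
apply: le_trans _ (lerD YNP (lexx _)).
lra.
Qed.

Theorem theorem3p1 (R : realType) (q : nat) (F : finFieldType) (hq : #|F| = q)
    (n k m r s : nat) (l : int)
    (hn : n = (m * k + r)%N) (hr : (r < k)%N)
    (hl : qnum (q%:R : R) (l - 1) < s%:R <= qnum (q%:R : R) l)
    (hnk : (2 * k <= n)%N)
    (Y : {set {vspace 'rV[F]_n}})
    (hEM : EM_family k s Y)
    (hY : EM_bound (q%:R : R) n k s l <= #|Y|%:R)
    (hs : 16 * s%:R <=
          Num.min ((q%:R : R) `^ ((n%:R - k%:R - l%:~R + 2) / 3))
         (Num.min ((q%:R : R) `^ ((n%:R - k%:R - r%:R) / 3))
                  ((q%:R : R) `^ (n%:R / 2 - k%:R + 1)))) :
  union_of_intersecting k s Y.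

Proof.
have k0 : (0 < k)%N by apply: leq_ltn_trans hr.
have [s1|s1] := leqP s 1.
  case: s s1 hEM {hl hY hs} => [|[|]] // _ hEM.
    by rewrite (EM_family0 hEM); apply: union_of_intersecting0.
  apply: (union_of_intersectingU (EM_family1 hEM) (@union_of_intersecting0 _ _ _)).
  by rewrite setU0.
have kn : (k <= n)%N by apply: leq_trans hnk; rewrite leq_pmull.
have q1 := q_gt1 F; rewrite hq in q1.
have q1R : 1 < (q%:R : R) by rewrite (ltr_nat _ 1).
have ss : ((16 * s) ^ 2 <= q ^ (n - 2 * k).+2)%N.
  move: hs; rewrite !le_min => /and3P[_ _ h3].
  rewrite -(ler_nat R) !natrX natrM.
  have q0 : 0 <= (q%:R : R) by apply: ler0n.
  have -> : (q%:R : R) ^+ (n - 2 * k).+2 = (q%:R `^ (n%:R / 2 - k%:R + 1)) ^+ 2.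
    rewrite -!powR_mulrn ?powR_ge0 // -powRrM; congr (_ `^ _).
    by rewrite -addn2 natrD natrB // natrM; field.
  by rewrite lerXn2r ?nnegrE ?mulr_ge0 ?powR_ge0 ?ler0n.
have [m' mE] : exists m', m = m'.+2.
  case: m hn hr hnk => [|[|m']] hn' hr' hnk'; last by exists m'.
  - by move: hnk' hr'; rewrite hn'; lia.
  - by move: hnk' hr'; rewrite hn'; lia.
have dV : \dim {:'rV[F]_n} = (m'.+2 * k + r)%N by rewrite dim_rVf hn mE.
have [S [SP Sd Scard]] := partial_spread_exists k0 dV.
rewrite hq dim_rVf in Scard.
have SK : S \subset kspaces F n k.
  by apply/subsetP => U /SP[dU _]; rewrite inE dU.
have n0 : (0 < n)%N by apply: leq_trans kn.
have [x x0] : exists x : 'rV[F]_n, x != 0.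
  by exists (vpick {:'rV[F]_n}); rewrite vpick0 -dimv_eq0 dim_rVf -lt0n.
apply: (@EM_decomposition F n k k0 hnk s S x s1 x0) => //; first by rewrite hq.
have dx : \dim <[x]> = 1%N by rewrite dim_vline x0.
set c := #|above (kspaces F n k) <[x]>|.
have cE : qbinom (q%:R : R) (n%:Z - 1) (k%:Z - 1) = c%:R.
  have := @qbinom_above R F n k k.-1 <[x]>%VS kn; rewrite dx hq => -> //.
  by rewrite add1n prednK.
(* For [k >= 2] this counts the [k]-spaces above a 2-space, at most [c / q ^ (n - k)], and
   [n - 2 * k + 2 <= n - k] makes [ss] applicable. For [k = 1] the coefficient is 0 by
   convention. *)
have [b0 bP] : 0 <= qbinom (q%:R : R) (n%:Z - 2) (k%:Z - 2) /\
    256 * s%:R ^+ 2 * qbinom (q%:R : R) (n%:Z - 2) (k%:Z - 2) <= c%:R.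
  have [k1|k2] := leqP k 1.
    have -> : k = 1%N by apply/eqP; rewrite eqn_leq k1.
    by rewrite /qbinom /= mulr0 lexx ler0n.
  have [y _ yx] : exists2 y, y \in {:'rV[F]_n}%VS & y \notin <[x]>%VS.
    apply/subvPn; apply/negP => /dimvS; by rewrite dim_rVf dx leqNgt (leq_trans k2 kn).
  have bE := @qbinom_above R F n k (k - 2) (<[x]> + <[y]>)%VS kn.
  rewrite dim_add_line // dx hq subnKC // in bE; rewrite -bE // ler0n; split=> //.
  rewrite -natrX -!natrM ler_nat; apply: leq_trans (above_step_le kn yx); rewrite hq mulnC.
  rewrite leq_mul2l; apply/orP; right.
  have -> : (256 * s ^ 2 = (16 * s) ^ 2)%N by rewrite expnMn.
  apply: leq_trans ss _; rewrite leq_exp2l //.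
  by rewrite (subn_double hnk) -addn2 leq_add2l.
(* Since [[l - 1] < s], the subtracted term is at most [s ^ 2] times the second coefficient, hence
   at most [c / 256]. *)
have Yl : 256 * s%:R * c%:R <= 256 * #|Y|%:R + c%:R :> R.
  case/andP: hl => ls _; move: hY; rewrite /EM_bound cE => hY'.
  have sR : 0 <= (s%:R : R) by apply: ler0n.
  have lb : qnum (q%:R : R) (l - 1) * qbinom q%:R (n%:Z - 2) (k%:Z - 2) <=
      s%:R * qbinom q%:R (n%:Z - 2) (k%:Z - 2) by rewrite ler_wpM2r // ltW.
  have slb := ler_wpM2l sR lb.
  move: bP hY' slb; rewrite mulrBr expr2 -!mulrA; lra.
rewrite -(ler_nat R) natrD !natrM.
(* From [r + 2 <= 2 * k] one gets [n - 2 * k + 2 <= 2 * (n - k - r)], so [ss] bounds [16 * s] by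
   [q ^ (n - k - r)]. *)
have sE : ((16 * s) * q ^ (k + r) <= q ^ n)%N.
  have krn : (k + r <= n)%N by rewrite hn mE mulSn -addnA leq_add2l leq_addl.
  have -> : (q ^ n = q ^ (n - (k + r)) * q ^ (k + r))%N by rewrite -expnD subnK.
  rewrite leq_mul2r; apply/orP; right; rewrite -leq_sqr; apply: leq_trans ss _.
  have e1 : (n - 2 * k = m' * k + r)%N by rewrite hn mE (_ : m'.+2 * k + r = m' * k + r + 2 * k)%N ?addnK //; ring.
  have e2 : (n - (k + r) = m' * k + k)%N.
    by rewrite hn mE (_ : m'.+2 * k + r = m' * k + k + (k + r))%N ?addnK //; ring.
  rewrite -expnM leq_exp2l // e1 e2 mulnDl -2!addnS leq_add ?leq_pmulr //.
  by rewrite muln2 -addnn -[r.+2]addn1 leq_add.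
have rec := above_line_rec k x0; rewrite hq -/c in rec.
have nat1 a : (0 < a)%N -> ((a - 1)%N%:R : R) = a%:R - 1 by move=> a0; rewrite natrB.
have qk0 i : (0 < q ^ i)%N by rewrite expn_gt0 ltnW.
apply: (@proportion_numeric _ _ _ (q ^ k - 1)%N%:R c%:R _ (q ^ n)%N%:R (q ^ (k + r))%N%:R) => //.
- by rewrite -nat1 // -!natrM mulnC rec mulnC.
- rewrite nat1 // mulrBr mulr1 -natrM lerBlDr addrAC lerBrDr -!natrD ler_nat.
  exact: Scard.
- by rewrite -!natrM ler_nat.
- by rewrite ltr0n subn_gt0 -(expn0 q) ltn_exp2l.
- by rewrite ltr0n above_line_gt0.
- by rewrite (ler_nat _ 1).
- by rewrite (ler_nat _ 1) ltnW.
Qed.
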